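(* There exists a polynomially convex arc $J$ in $\mathbb{C}^3$ that is disjoint from the closed unit ball $\overline{\mathbb{B}}$ of $\mathbb{C}^3$ such that $\overline{\mathbb{B}}\cup J$ is not rationally convex.
   Context: An arc is a space homeomorphic to the closed unit interval. For a compact set $X\subset\mathbb{C}^N$, the polynomial hull is $\widehat X=\{z\in\mathbb{C}^N:|p(z)|\le\max_{x\in X}|p(x)|\text{ for all polynomials }p\}$ and the rational hull is $h_r(X)=\{z\in\mathbb{C}^N:p(z)\in p(X)\text{ for all polynomials }p\}$, where polynomials are in the complex coordinates. $X$ is polynomially convex if $\widehat X=X$ and rationally convex if $h_r(X)=X$. *)

(* Defs.v *)
From mathcomp Require Import all_boot all_order all_algebra.
From mathcomp Require Import all_classical all_reals all_analysis.
From mathcomp Require Import complex.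
(* Loaded without [Import]: its notations clash with those of analysis. *)
From mathcomp Require mpoly.

Set Implicit Arguments.
Unset Strict Implicit.
Unset Printing Implicit Defensive.

Import Order.TTheory GRing.Theory Num.Theory.
Import numFieldNormedType.Exports.

Local Open Scope classical_set_scope.
Local Open Scope ring_scope.
Local Open Scope complex_scope.

(* C^N. The alias [^o] gives R[i] the topology of its modulus; row vectors
   then carry the product topology. *)
Definition CN (R : realType) (N : nat) := 'rV[R[i]^o]_N.

(* The library norm of R[i] is valued in R[i]; it is real, so [Re] loses
   nothing. *)
Definition cmod (R : realType) (z : R[i]) : R := complex.Re `|z|.

Definition enorm (R : realType) (N : nat) (z : CN R N) : R :=
  Num.sqrt (\sum_(i < N) cmod (z ord0 i) ^+ 2).

Definition closed_unit_ball (R : realType) (N : nat) : set (CN R N) :=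
  [set z | enorm z <= 1].
Arguments closed_unit_ball : clear implicits.

Definition peval (R : realType) (N : nat) (p : mpoly.mpoly N R[i])
  (z : CN R N) : R[i] := mpoly.meval (fun i : 'I_N => z ord0 i : R[i]) p.

(* The hulls are meant for compact X, where the supremum is a maximum; for
   X = set0 the polynomial hull is empty, since [sup set0 = 0]. *)
Definition poly_hull (R : realType) (N : nat) (X : set (CN R N)) :
    set (CN R N) :=
  [set z | forall p : mpoly.mpoly N R[i],
     cmod (peval p z) <= sup [set cmod (peval p x) | x in X]].

Definition rat_hull (R : realType) (N : nat) (X : set (CN R N)) :
    set (CN R N) :=
  [set z | forall p : mpoly.mpoly N R[i], (peval p @` X) (peval p z)].

Definition poly_convex (R : realType) (N : nat) (X : set (CN R N)) : Prop :=
  poly_hull X = X.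

Definition rat_convex (R : realType) (N : nat) (X : set (CN R N)) : Prop :=
  rat_hull X = X.

(* Homeomorphism of subsets for their subspace topologies; the values of f
   outside A and of g outside B are irrelevant. *)
Definition homeomorphic_sets (S T : topologicalType) (A : set S) (B : set T) :
    Prop :=
  exists (f : S -> T) (g : T -> S),
    [/\ {within A, continuous f} /\ {within B, continuous g},
        set_fun A B f, set_fun B A g,
        {in A, cancel f g} & {in B, cancel g f}].

Definition is_arc (R : realType) (N : nat) (J : set (CN R N)) : Prop :=
  homeomorphic_sets (`[0, 1] : set R) J.

(* Main.v *)
Require Import Defs.
From mathcomp Require Import all_boot all_order all_algebra.
From mathcomp Require Import all_classical all_reals all_analysis.
From mathcomp Require Import complex ring lra.
From mathcomp Require mpoly.

(** Let [E] be an arc in the plane, and let [f] be a continuous function on the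
    plane that is holomorphic off [E], is not constant and satisfies
    [z * f z --> 1] at infinity. The functions [f] and [z * f z - 1] have no
    common zero, and both tend to zero at infinity. Hence, for suitable
    constants [eps] and [k], the map
      [F z = (eps * z, k * f z, k * (z * f z - 1))]
    sends [E] outside the closed unit ball and a large circle inside it. The arc
    of the theorem is [J = F E].

    [J] is polynomially convex. It is the graph of a pair of functions over
    [eps * E], and [f] is on [E] a uniform limit of rational functions with poles
    off [E], hence of polynomials ([poly_approx_rational]). The poles can be
    pushed to infinity since an arc does not separate the plane
    ([poly_approx_pole]).

    The union of the ball and [J] is not rationally convex. Let [D] be the disc
    bounded by the large circle and let [p] be a polynomial without zeros on the
    ball and on [J]. Then [p \o F] has a continuous argument along the circle,
    because the ball is contractible, and it has no zeros on [E]. If it were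
    holomorphic on all of [D] it would have no zeros there by the argument
    principle. The arc does no harm: [f] is a uniform limit of functions that are
    rational off neighbourhoods of [E] shrinking to [E], and [p \o F] has no zeros
    near [E]. An approximant therefore has finitely many zeros in [D]; dividing
    them out leaves a zero-free continuous function on a disc, which has winding
    number zero along the circle, while each zero contributes one turn
    ([disc_no_root], [zero_free_limit]). So [F z] lies in the rational hull for
    every [z] in [D], and by connectedness some [F z] lies neither in the ball
    nor on [J]. Complex analysis enters only through this winding number.

    For [E] and [f] a self-similar arc is used. Two copies of a rectangle, scaled
    by 3/5 and turned by a right angle, fit in the rectangle; joining them by
    segments gives a path that contains two copies of itself
    ([fractal_path_exists]). Since 3/5 exceeds 1/2, the natural measure on the
    Cantor set of the construction has a continuous Cauchy transform [f]. It is
    obtained as the limit of the transforms of uniform measures on 2^n small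
    discs placed beside the arc, whose successive differences are contracted by
    a transfer operator ([transfer_contract]). Off the discs these transforms are
    rational, with poles off [E]. *)


Set Implicit Arguments.
Unset Strict Implicit.
Unset Printing Implicit Defensive.

Import Order.TTheory GRing.Theory Num.Theory.
Import numFieldNormedType.Exports.

Local Open Scope classical_set_scope.
Local Open Scope ring_scope.
Local Open Scope complex_scope.

(** * Modulus and continuity in the complex plane *)

Section Modulus.
Variable R : realType.
Implicit Types (z w : R[i]) (x y e : R).

Lemma cmodE z : cmod z = Num.sqrt (complex.Re z ^+ 2 + complex.Im z ^+ 2).
Proof. by rewrite /cmod normc_def. Qed.

Lemma normC_cmod z : `|z| = (cmod z)%:C.
Proof. by rewrite cmodE normc_def. Qed.

Lemma cmod_ge0 z : 0 <= cmod z.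
Proof. by rewrite cmodE sqrtr_ge0. Qed.
Hint Resolve cmod_ge0 : core.

Lemma cmodM z w : cmod (z * w) = cmod z * cmod w.
Proof. by apply: complexI; rewrite -normC_cmod normrM !normC_cmod -rmorphM. Qed.

Lemma cmodV z : cmod z^-1 = (cmod z)^-1.
Proof. by apply: complexI; rewrite -normC_cmod normfV normC_cmod fmorphV. Qed.

Lemma cmodN z : cmod (- z) = cmod z.
Proof. by rewrite /cmod normrN. Qed.

Lemma cmod_distC z w : cmod (z - w) = cmod (w - z).
Proof. by rewrite /cmod distrC. Qed.

Lemma ler_cmodD z w : cmod (z + w) <= cmod z + cmod w.
Proof. by rewrite -lecR rmorphD/= -!normC_cmod ler_normD. Qed.

Lemma ler_cmodB z w : cmod z - cmod w <= cmod (z - w).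
Proof. by rewrite lerBlDr (le_trans _ (ler_cmodD _ _))// subrK. Qed.

Lemma cmod_eq0 z : (cmod z == 0) = (z == 0).
Proof. by rewrite -(inj_eq (@complexI R)) -normC_cmod normr_eq0. Qed.

Lemma cmod_gt0 z : (0 < cmod z) = (z != 0).
Proof. by rewrite lt0r cmod_eq0 cmod_ge0 andbT. Qed.

Lemma cmod0 : cmod (0 : R[i]) = 0.
Proof. by apply/eqP; rewrite cmod_eq0. Qed.

Lemma cmod_real x : cmod x%:C = `|x|.
Proof. by rewrite cmodE/= expr0n addr0 sqrtr_sqr. Qed.

Lemma cmod1 : cmod (1 : R[i]) = 1.
Proof. by rewrite -(rmorph1 (real_complex R)) cmod_real normr1. Qed.

Lemma cmodX z n : cmod (z ^+ n) = cmod z ^+ n.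
Proof. by elim: n => [|n IH]; rewrite ?expr0 ?cmod1// !exprS cmodM IH. Qed.

Lemma cmod_sqr z : cmod z ^+ 2 = complex.Re z ^+ 2 + complex.Im z ^+ 2.
Proof. by rewrite cmodE sqr_sqrtr// addr_ge0// sqr_ge0. Qed.

Lemma cmod_conj z : cmod (z^*)%C = cmod z.
Proof. by case: z => a b; rewrite !cmodE/= sqrrN. Qed.

Lemma normr_Re_le z : `|complex.Re z| <= cmod z.
Proof. by rewrite cmodE -sqrtr_sqr ler_wsqrtr// lerDl sqr_ge0. Qed.

Lemma normr_Im_le z : `|complex.Im z| <= cmod z.
Proof. by rewrite cmodE -sqrtr_sqr ler_wsqrtr// lerDr sqr_ge0. Qed.

Lemma cmod_le_ReIm z : cmod z <= `|complex.Re z| + `|complex.Im z|.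
Proof.
case: z => a b; rewrite (_ : a +i* b = a%:C + 'i * b%:C); last first.
  by simpc.
rewrite (le_trans (ler_cmodD _ _))// cmodM !cmod_real (_ : cmod 'i = 1) ?mul1r//.
  by simpc.
by rewrite cmodE /= expr0n add0r expr1n sqrtr1.
Qed.

End Modulus.
#[global] Hint Resolve cmod_ge0 : core.

Section Continuity.
Variable R : realType.
Local Notation C := (R[i]^o).

Lemma cvg_cmodP (T : Type) (F : set_system T) {FF : Filter F} (f : T -> C)
    (l : C) :
  f @ F --> l <-> forall e : R, 0 < e -> \forall x \near F, cmod (f x - l) < e.
Proof.
split.
  move=> /cvgrPdist_lt h e e0.
  have /h : 0 < e%:C :> R[i] by rewrite ltcR.
  apply: filterS => x; rewrite normC_cmod ltcR; by rewrite cmod_distC.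
move=> h; apply/cvgrPdist_lt => e e0.
have er : e = (complex.Re e)%:C by rewrite RRe_real// gtr0_real.
rewrite er; have /h : 0 < complex.Re e by rewrite -ltcR -er.
by apply: filterS => x; rewrite normC_cmod ltcR cmod_distC.
Qed.

Lemma nbhs_cmodP (z : C) (P : set C) :
  nbhs z P <-> exists2 d : R, 0 < d & forall w, cmod (w - z) < d -> P w.
Proof.
split.
  move=> /nbhs_ballP[e /= e0 h].
  have er : e = (complex.Re e)%:C by rewrite RRe_real// gtr0_real.
  exists (complex.Re e); first by rewrite -ltcR -er.
  move=> w hw; apply: h; rewrite /ball/= er normC_cmod ltcR.
  by rewrite cmod_distC.
move=> [d d0 h]; apply/nbhs_ballP; exists d%:C; first by rewrite /= ltcR.
move=> w; rewrite /ball/= normC_cmod ltcR cmod_distC; exact: h.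
Qed.

Lemma continuous_cmodP (T : topologicalType) (f : T -> C) (x : T) :
  {for x, continuous f} <->
  forall e : R, 0 < e -> \forall y \near x, cmod (f y - f x) < e.
Proof. exact: cvg_cmodP. Qed.

Lemma continuous_realP (T : topologicalType) (f : T -> R) (x : T) :
  {for x, continuous f} <->
  forall e : R, 0 < e -> \forall y \near x, `|f y - f x| < e.
Proof.
split=> h.
  by move=> e e0; move/cvgrPdist_lt: h => /(_ e e0); apply: filterS => y; rewrite distrC.
apply/cvgrPdist_lt => e e0; have := h e e0.
by apply: filterS => y; rewrite distrC.
Qed.

Lemma continuous_compose (T U V : topologicalType) (f : T -> U) (g : U -> V)
    (x : T) :
  {for x, continuous f} -> {for f x, continuous g} ->
  {for x, continuous (fun y => g (f y))}.
Proof. exact: continuous_comp. Qed.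

Lemma continuous_fun_cst (T U : topologicalType) (c : U) (x : T) :
  {for x, continuous (fun _ : T => c)}.
Proof. exact: cvg_cst. Qed.

Lemma continuous_pair2 (S T U : topologicalType) (f : S -> T) (g : S -> U)
    (x : S) :
  {for x, continuous f} -> {for x, continuous g} ->
  {for x, continuous (fun y => (f y, g y))}.
Proof.
by move=> hf hg; rewrite /prop_for /continuous_at; apply: cvg_pair; [exact: hf|exact: hg].
Qed.

Lemma continuous_fst2 (T U : topologicalType) (x : T * U) :
  {for x, continuous (fun y : T * U => y.1)}.
Proof. exact: cvg_fst. Qed.

Lemma continuous_snd2 (T U : topologicalType) (x : T * U) :
  {for x, continuous (fun y : T * U => y.2)}.
Proof. exact: cvg_snd. Qed.

Lemma Re_gt0_near1 (z : R[i]) : cmod (z - 1) < 1 -> 0 < complex.Re z.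
Proof.
move=> h; have := le_lt_trans (normr_Re_le (z - 1)) h.
by rewrite raddfB/= ltr_norml => /andP[]; lra.
Qed.

Section pointwise.
Variables (T : topologicalType) (x : T).
Implicit Types (f g : T -> C) (a b : T -> R).

Lemma continuousC_cst (c : C) : {for x, continuous (fun _ : T => c)}.
Proof. exact: cvg_cst. Qed.

Lemma continuousC_D f g : {for x, continuous f} -> {for x, continuous g} ->
  {for x, continuous (fun y => f y + g y : C)}.
Proof. by move=> hf hg; exact: (cvgD hf hg). Qed.

Lemma continuousC_B f g : {for x, continuous f} -> {for x, continuous g} ->
  {for x, continuous (fun y => f y - g y : C)}.
Proof. by move=> hf hg; exact: (cvgB hf hg). Qed.

Lemma continuousC_M f g : {for x, continuous f} -> {for x, continuous g} ->
  {for x, continuous (fun y => f y * g y : C)}.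
Proof. by move=> hf hg; exact: (cvgM hf hg). Qed.

Lemma continuousC_V f : f x != 0 -> {for x, continuous f} ->
  {for x, continuous (fun y => (f y)^-1 : C)}.
Proof. by move=> *; apply: cvgV. Qed.

Lemma continuousC_Re f : {for x, continuous f} ->
  {for x, continuous (fun y => complex.Re (f y) : R)}.
Proof.
move=> /continuous_cmodP h; apply/continuous_realP => e /h.
by apply: filterS => y; apply: le_lt_trans; rewrite -raddfB normr_Re_le.
Qed.

Lemma continuousC_Im f : {for x, continuous f} ->
  {for x, continuous (fun y => complex.Im (f y) : R)}.
Proof.
move=> /continuous_cmodP h; apply/continuous_realP => e /h.
by apply: filterS => y; apply: le_lt_trans; rewrite -raddfB normr_Im_le.
Qed.

Lemma continuousC_cmod f : {for x, continuous f} ->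
  {for x, continuous (fun y => cmod (f y) : R)}.
Proof.
move=> /continuous_cmodP h; apply/continuous_realP => e /h.
apply: filterS => y; apply: le_lt_trans.
by rewrite ler_norml lerNl opprB ler_cmodB cmod_distC ler_cmodB.
Qed.

Lemma continuousC_pair a b : {for x, continuous a} -> {for x, continuous b} ->
  {for x, continuous (fun y => (a y +i* b y) : C)}.
Proof.
move=> /continuous_realP ha /continuous_realP hb; apply/continuous_cmodP => e e0.
have e2 : 0 < e / 2 by rewrite divr_gt0.
near=> y; rewrite (splitr e); apply: le_lt_trans (cmod_le_ReIm _) _ => /=.
by apply: ltrD; near: y; [exact: ha|exact: hb].
Unshelve. all: by end_near. Qed.

Lemma continuousC_real a : {for x, continuous a} ->
  {for x, continuous (fun y => (a y)%:C : C)}.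
Proof. by move=> h; apply: continuousC_pair => //; exact: cvg_cst. Qed.

Lemma continuousC_conj f : {for x, continuous f} ->
  {for x, continuous (fun y => ((f y)^*)%C : C)}.
Proof.
move=> /continuous_cmodP h; apply/continuous_cmodP => e /h.
by apply: filterS => y; rewrite -rmorphB cmod_conj.
Qed.

End pointwise.
End Continuity.

(** * Continuous arguments and winding *)

Section Winding.
Variable R : realType.
Local Notation C := (R[i]^o).
Implicit Types (z w : R[i]) (s t x y e : R).

Definition cis x : R[i] := cos x +i* sin x.

Lemma cisD x y : cis (x + y) = cis x * cis y.
Proof.
rewrite /cis cosD sinD; apply/eqP; rewrite eq_complex/=; apply/andP; split=> //.
by rewrite addrC [cos x * _]mulrC [sin x * _]mulrC mulrC.
Qed.

Lemma cis0 : cis 0 = 1.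
Proof. by rewrite /cis cos0 sin0. Qed.

Lemma cisN x : cis (- x) = (cis x)^-1.
Proof.
have h : cis x * cis (- x) = 1 by rewrite -cisD subrr cis0.
have n0 : cis x != 0.
  by apply: contra_eq_neq h => ->; rewrite mul0r eq_sym oner_neq0.
by apply: (mulfI n0); rewrite h divff.
Qed.

Lemma cmod_cis x : cmod (cis x) = 1.
Proof. by rewrite cmodE/= cos2Dsin2 sqrtr1. Qed.

Lemma cisMn x n : cis (x *+ n) = cis x ^+ n.
Proof. by elim: n => [|n IH]; rewrite ?mulr0n ?cis0 ?expr0// mulrS cisD IH exprS. Qed.

Lemma continuous_cis (T : topologicalType) (f : T -> R) (p : T) :
  {for p, continuous f} -> {for p, continuous (fun q => cis (f q) : C)}.
Proof.
move=> hf; apply: continuousC_pair.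
  exact: (continuous_compose hf (@continuous_cos R _)).
exact: (continuous_compose hf (@continuous_sin R _)).
Qed.

(** The branch of the argument on the right half-plane. *)
Definition arg0 z : R := atan (complex.Im z / complex.Re z).

Lemma arg0P z : 0 < complex.Re z -> z = (cmod z)%:C * cis (arg0 z).
Proof.
case: z => a b /= a0; rewrite /arg0 /cis/=.
have ha : 0 < cmod (a +i* b).
  by rewrite cmod_gt0; apply: contraTneq a0 => -[-> _]; rewrite ltxx.
have ca : cos (atan (b / a)) = a / cmod (a +i* b).
  rewrite cos_atan cmodE/=.
  have -> : 1 + (b / a) ^+ 2 = (a ^+ 2 + b ^+ 2) / a ^+ 2.
    by field; rewrite gt_eqF.
  rewrite sqrtrM ?addr_ge0 ?sqr_ge0// sqrtrV ?sqr_ge0// sqrtr_sqr gtr0_norm//.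
  by rewrite invfM invrK mulrC.
have sa : sin (atan (b / a)) = b / cmod (a +i* b).
  have cn : cos (atan (b / a)) != 0.
    by rewrite ca mulf_neq0 ?invr_eq0 ?gt_eqF.
  have := atanK (b / a); rewrite /tan => /(congr1 (fun u => u * cos (atan (b / a)))).
  rewrite divfK// => ->; rewrite ca.
  by field; rewrite !gt_eqF.
rewrite ca sa; simpc.
by congr (_ +i* _); rewrite mulrC divfK// gt_eqF.
Qed.

Lemma continuous_arg0 (T : topologicalType) (f : T -> C) (p : T) :
  0 < complex.Re (f p) -> {for p, continuous f} ->
  {for p, continuous (fun q => arg0 (f q) : R)}.
Proof.
move=> p0 hf; apply: (@continuous_compose _ _ _ _ (@atan R)); last exact: continuous_atan.
apply: cvgM; first exact: continuousC_Im.
by apply: cvgV; [rewrite gt_eqF|exact: continuousC_Re].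
Qed.

Lemma polar_form z : z != 0 -> exists x, z = (cmod z)%:C * cis x.
Proof.
move=> z0.
have [h|h|h] := ltgtP 0 (complex.Re z).
- by exists (arg0 z); exact: arg0P.
- exists (arg0 (- z) + pi).
  have h' : 0 < complex.Re (- z) by rewrite raddfN oppr_gt0.
  rewrite cisD mulrA -(cmodN z) -arg0P//.
  by rewrite /cis cospi sinpi; case: z {z0 h h'} => a b; simpc.
- case: z h z0 => a b /= <- b0.
  have {}b0 : b != 0 by apply: contra_neq b0 => ->.
  have [h|h|h] := ltgtP 0 b; last by rewrite -h eqxx in b0.
  + exists (pi / 2); rewrite /cis cos_pihalf sin_pihalf cmodE/= expr0n add0r.
    by rewrite sqrtr_sqr gtr0_norm//; simpc.
  + exists (- (pi / 2)); rewrite /cis cosN sinN cos_pihalf sin_pihalf cmodE/=.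
    by rewrite expr0n add0r sqrtr_sqr ltr0_norm//; simpc.
Qed.

Lemma cos_cis_inj x y : cis x = cis y -> cos (x - y) = 1.
Proof.
move=> h; have : cis (x - y) = 1.
  rewrite cisD cisN h divff// -cmod_eq0 cmod_cis oner_neq0 //.
by case.
Qed.

Definition clamp t : R := Num.max 0 (Num.min 1 t).

Lemma clamp_itv t : 0 <= clamp t <= 1.
Proof. by rewrite /clamp le_max lexx/= ge_max ler01 ge_min lexx. Qed.

Lemma clamp_id t : 0 <= t <= 1 -> clamp t = t.
Proof. by move=> /andP[h0 h1]; rewrite /clamp min_r// max_r. Qed.

Lemma clamp_le0 t : t <= 0 -> clamp t = 0.
Proof. by move=> h; rewrite /clamp min_r ?max_l// (le_trans h). Qed.

Lemma clamp_ge1 t : 1 <= t -> clamp t = 1.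
Proof. by move=> h; rewrite /clamp min_l// max_r. Qed.

Lemma continuous_clamp : continuous clamp.
Proof.
move=> t; apply: continuous_max; first exact: cvg_cst.
by apply: continuous_min; [exact: cvg_cst|exact: cvg_id].
Qed.

End Winding.

Section Lift.
Variable R : realType.
Local Notation C := (R[i]^o).
Implicit Types (t s d e : R).

(** Compactness of the square gives one mesh for which all the quotients of
    neighbouring values of [H] lie in the right half-plane. *)
Lemma small_quotients (H : R -> R -> R[i]) :
  (forall p : R * R, {for p, continuous (fun q : R * R => H q.1 q.2 : C)}) ->
  (forall t s, 0 <= t <= 1 -> 0 <= s <= 1 -> H t s != 0) ->
  exists2 d, 0 < d & forall t t' s, 0 <= t <= 1 -> 0 <= t' <= 1 ->
    0 <= s <= 1 -> `|t - t'| < d -> 0 < complex.Re (H t s / H t' s).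
Proof.
move=> Hc Hn.
pose K := [set p : R * R | `[0, 1]%classic p.1 /\ `[0, 1]%classic p.2].
have cK : compact K.
  by have := compact_setX (@segment_compact R 0 1) (@segment_compact R 0 1).
move/compact_near_coveringP : cK.
pose P d (p : R * R) :=
  forall t, 0 <= t <= 1 -> `|t - p.1| < d -> 0 < complex.Re (H t p.2 / H p.1 p.2).
move=> /(_ R 0^'+ P _) near.
have : \forall d \near 0^'+, K `<=` P d.
  apply: near => -[t0 s0] /= [tI sI].
  have H00 : H t0 s0 != 0.
    by apply: Hn; [move: tI|move: sI]; rewrite /= in_itv.
  pose G (q : (R * R) * R) : C := H q.2 q.1.2 / H q.1.1 q.1.2.
  have cG : {for ((t0, s0), t0), continuous G}.
    apply: continuousC_M.
      apply: (@continuous_compose _ _ _ (fun q : (R * R) * R => (q.2, q.1.2))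
        (fun q : R * R => H q.1 q.2 : C)); last exact: Hc.
      apply: continuous_pair2; first exact: continuous_snd2.
      apply: (@continuous_compose _ _ _ (fun q : (R * R) * R => q.1)
        (fun q : R * R => q.2)); [exact: continuous_fst2|exact: continuous_snd2].
    apply: continuousC_V => //=.
    apply: (@continuous_compose _ _ _ (fun q : (R * R) * R => q.1)
        (fun q : R * R => H q.1 q.2 : C)); last exact: Hc.
    exact: continuous_fst2.
  have /continuous_cmodP/(_ 1 ltr01) := cG.
  rewrite /G/= divff//= => /nbhs_ballP[e /= e0 he].
  have e2 : 0 < e / 2 by rewrite divr_gt0.
  exists (ball (t0, s0) (e / 2), [set d | 0 < d < e / 2]) => /=.
    split; first exact: nbhsx_ballx.
    near=> d; apply/andP; split; near: d; first exact: nbhs_right_gt.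
    exact: nbhs_right_lt.
  move=> [[t1 s1] d] /= [[/= b1 b2] /andP[d0 de]] t tI' htd.
  apply: Re_gt0_near1; apply: (he ((t1, s1), t)).
  have ee : e / 2 <= e by lra.
  split; first by split=> /=; apply: le_ball ee _ _.
  rewrite /ball/= in b1 *; rewrite (_ : t0 - t = (t0 - t1) + (t1 - t)); last by ring.
  rewrite (le_lt_trans (ler_normD _ _))// (splitr e) ltrD//.
  by rewrite distrC (lt_trans htd).
move=> hP; have hP2 : \forall d \near 0^'+, K `<=` P d /\ 0 < d.
  by near=> d; split; near: d => //; exact: nbhs_right_gt.
have [d [dP d0]] := @filter_ex _ _ (at_right_proper_filter 0) _ hP2.
exists d => // t t' s tI tI' sI htd.
by apply: (dP (t', s)) => //; split; rewrite /= in_itv.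
Unshelve. all: by end_near. Qed.

(** A homotopy of nowhere vanishing loops starting at a constant one carries a
    continuous argument: sum the principal arguments of the successive
    quotients. The last clause records that the result only depends on the
    track of the homotopy, so closed homotopies give periodic arguments. *)
Lemma arg_lift (H : R -> R -> R[i]) :
  (forall p : R * R, {for p, continuous (fun q : R * R => H q.1 q.2 : C)}) ->
  (forall t s, 0 <= t <= 1 -> 0 <= s <= 1 -> H t s != 0) ->
  (forall s, 0 <= s <= 1 -> H 0 s = H 0 0) ->
  exists theta : R -> R, [/\ continuous theta,
    forall s, 0 <= s <= 1 -> H 1 s = (cmod (H 1 s))%:C * cis (theta s) &
    forall s s', 0 <= s <= 1 -> 0 <= s' <= 1 ->
      (forall t, 0 <= t <= 1 -> H t s = H t s') -> theta s = theta s'].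
Proof.
move=> Hc Hn H0.
have [d d0 Hd] := small_quotients Hc Hn.
pose m := (Num.truncn d^-1).+1.
have m0 : 0 < m%:R :> R by rewrite ltr0n.
have md : (m%:R : R)^-1 < d.
  rewrite -[ltRHS]invrK ltf_pV2 ?posrE ?invr_gt0//.
  by rewrite /m truncnS_gt.
pose tj j : R := j%:R / m%:R.
have tjI j : (j <= m)%N -> 0 <= tj j <= 1.
  by move=> jm; rewrite /tj divr_ge0//= ler_pdivrMr// mul1r ler_nat.
have H00 : H 0 0 != 0 by apply: Hn; rewrite lexx ler01.
have [x0 hx0] := polar_form H00.
pose q j s := H (tj j.+1) s / H (tj j) s.
have qpos j s : (j < m)%N -> 0 <= s <= 1 -> 0 < complex.Re (q j s).
  move=> jm sI; apply: Hd => //; [exact: tjI|exact/tjI/ltnW|].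
  rewrite /tj -mulrBl -natrB// subSnn mul1r ger0_norm ?invr_ge0 ?ler0n//.
pose th n s := x0 + \sum_(j < n) arg0 (q j (clamp s)).
have thP n s : (n <= m)%N -> 0 <= s <= 1 ->
    H (tj n) s = (cmod (H (tj n) s))%:C * cis (th n s).
  move=> + sI; elim: n => [_|n IH nm].
    by rewrite /tj mul0r H0// /th big_ord0 addr0.
  have Hnz : H (tj n) s != 0 by apply: Hn => //; exact/tjI/ltnW.
  have -> : H (tj n.+1) s = H (tj n) s * q n s by rewrite /q mulrCA divff// mulr1.
  have -> : th n.+1 s = th n s + arg0 (q n s).
    by rewrite {1}/th big_ord_recr/= addrA -/(th n s) clamp_id.
  rewrite {1}IH 1?ltnW// {1}(@arg0P _ (q n s)) ?qpos//.
  by rewrite cmodM rmorphM/= cisD mulrACA.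
have tm : tj m = 1 by rewrite /tj divff// gt_eqF.
exists (th m); split.
- move=> s.
  have cq t : {for s, continuous (fun s => H t (clamp s) : C)}.
    apply: (@continuous_compose _ _ _ (fun s => (t, clamp s))
        (fun q : R * R => H q.1 q.2 : C)); last exact: Hc.
    by apply: continuous_pair2; [exact: cvg_cst|exact: continuous_clamp].
  rewrite /th; apply: cvgD; first exact: cvg_cst.
  elim: {-2}m (leqnn m) => [_|j IH jm].
    by under eq_fun do rewrite big_ord0; rewrite big_ord0; exact: cvg_cst.
  under eq_fun do rewrite big_ord_recr/=; rewrite big_ord_recr/=.
  apply: cvgD; first exact/IH/ltnW.
  apply: (@continuous_arg0 _ _ (fun s => q j (clamp s)) s).
    by apply: qpos => //; exact: clamp_itv.
  have nz : H (tj j) (clamp s) != 0.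
    by apply: Hn; [exact/tjI/ltnW|exact: clamp_itv].
  have cqV := @continuousC_V _ _ _ (fun s => H (tj j) (clamp s)) nz (cq (tj j)).
  exact: (continuousC_M (cq (tj j.+1)) cqV).
- by move=> s sI; rewrite -{1}tm thP// tm.
- move=> s s' sI sI' hss; congr (x0 + _); apply: eq_bigr => j _.
  by rewrite /q !clamp_id// !hss// tjI// ltnW.
Qed.

(** For a closed path off the origin, parametrised by the unit interval: its
    winding number about the origin is zero. *)
Definition has_periodic_arg (w : R -> R[i]) := exists theta : R -> R,
  [/\ continuous theta, theta 0 = theta 1 &
    forall s, 0 <= s <= 1 -> w s = (cmod (w s))%:C * cis (theta s)].

Lemma has_periodic_argM w1 w2 : has_periodic_arg w1 -> has_periodic_arg w2 ->
  has_periodic_arg (fun s => w1 s * w2 s).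
Proof.
move=> [a [ca pa ha]] [b [cb pb hb]]; exists (fun s => a s + b s); split.
- by move=> s; apply: cvgD; [exact: ca|exact: cb].
- by rewrite pa pb.
- by move=> s sI; rewrite {1}ha// {1}hb// cmodM rmorphM/= cisD mulrACA.
Qed.

Lemma has_periodic_argV w : has_periodic_arg w ->
  has_periodic_arg (fun s => (w s)^-1).
Proof.
move=> [a [ca pa ha]]; exists (fun s => - a s); split.
- by move=> s; apply: cvgN; exact: ca.
- by rewrite pa.
- by move=> s sI; rewrite {1}ha// invfM cmodV fmorphV/= cisN.
Qed.

Lemma eq_has_periodic_arg w1 w2 : (forall s, 0 <= s <= 1 -> w1 s = w2 s) ->
  has_periodic_arg w1 -> has_periodic_arg w2.
Proof.
move=> e [a [ca pa ha]]; exists a; split=> // s sI.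
by rewrite -!e// -ha.
Qed.

Lemma has_periodic_arg_Re_gt0 (w : R -> R[i]) : continuous (w : R -> C) ->
  (forall s, 0 <= s <= 1 -> 0 < complex.Re (w s)) -> w 0 = w 1 ->
  has_periodic_arg w.
Proof.
move=> cw pw w01; exists (fun s => arg0 (w (clamp s))); split.
- move=> s; apply: (@continuous_arg0 _ _ (fun s => w (clamp s)) s).
    exact/pw/clamp_itv.
  exact: (@continuous_compose _ _ _ (@clamp R) (w : R -> C) s
    (@continuous_clamp R s) (cw _)).
- by rewrite !clamp_id ?lexx ?ler01// w01.
- by move=> s sI; rewrite clamp_id// -arg0P// pw.
Qed.

(** Otherwise [theta s - 2 * pi * k * s] would be a continuous function with
    values in the multiples of [2 * pi], taking values [2 * pi * k] apart. *)
Lemma no_periodic_arg_cisX (k : nat) : (0 < k)%N ->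
  ~ has_periodic_arg (fun s => cis (s * (2 * pi)) ^+ k).
Proof.
move=> k0 [a [ca pa ha]].
pose D s := a s - (s * (2 * pi)) *+ k.
have cD : continuous D.
  move=> s; apply: cvgB; first exact: ca.
  apply: cvgMn; apply: cvgMr_tmp; exact: cvg_id.
have D1 s : 0 <= s <= 1 -> cos (D s) = 1.
  move=> sI; apply: cos_cis_inj; rewrite cisMn.
  by have := ha s sI; rewrite cmodX cmod_cis expr1n mul1r.
have [s sI Ds] : exists2 s, s \in `[0, 1] & D s = D 0 - pi.
  have pi0 := pi_gt0 R.
  have D10 : D 1 = D 0 - (2 * pi) *+ k by rewrite /D mul0r mul0rn mul1r pa subr0.
  have le : pi <= (2 * pi) *+ k :> R.
    apply: (@le_trans _ _ (2 * pi)); first by lra.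
    by rewrite -[leLHS]mulr1n ler_wpMn2l// ; lra.
  apply: IVT; rewrite ?ler01//; first exact: continuous_subspaceT.
  rewrite D10 ge_min le_max; apply/andP; split; apply/orP; [right|left]; lra.
have := D1 s; rewrite Ds cosB cospi sinpi mulr0 addr0 mulrN1 D1 ?lexx ?ler01//.
by move: sI; rewrite in_itv/= => -> /(_ isT); lra.
Qed.

End Lift.

Section Circle.
Variable R : realType.
Local Notation C := (R[i]^o).
Implicit Types (s t rad : R).

Definition circle rad s : R[i] := rad%:C * cis (s * (2 * pi)).

Lemma cmod_circle rad s : 0 <= rad -> cmod (circle rad s) = rad.
Proof. by move=> h; rewrite cmodM cmod_cis cmod_real mulr1 ger0_norm. Qed.

Lemma circle01 rad : circle rad 0 = circle rad 1.
Proof.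
by rewrite /circle mul0r mul1r cis0 /cis mulr_natl cos2pi sin2pi.
Qed.

Lemma continuous_circle rad s : {for s, continuous (circle rad : R -> C)}.
Proof.
apply: (@continuousC_M _ _ s (fun=> rad%:C) (fun s => cis (s * (2 * pi)))).
  exact: cvg_cst.
apply: (@continuous_cis _ _ (fun s => s * (2 * pi)) s).
by apply: cvgMr_tmp; exact: cvg_id.
Qed.

Lemma disc_periodic_arg (v : R[i] -> R[i]) rad : 0 <= rad ->
  continuous (v : C -> C) -> (forall z, cmod z <= rad -> v z != 0) ->
  has_periodic_arg (fun s => v (circle rad s)).
Proof.
move=> rad0 cv v0.
have [||t|th [cth hth pth]] :=
    @arg_lift R (fun t s => v (t%:C * circle rad s)).
- move=> p.
  suff h : {for p, continuous (fun q : R * R => q.1%:C * circle rad q.2 : C)}.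
    exact: (@continuous_compose _ _ _ _ (v : C -> C) p h (cv _)).
  apply: (@continuousC_M _ _ p (fun q : R * R => q.1%:C)
                               (fun q : R * R => circle rad q.2)).
    apply: (@continuousC_real _ _ p (fun q : R * R => q.1)).
    exact: continuous_fst2.
  exact: (@continuous_compose _ _ _ (fun q : R * R => q.2) (circle rad : R -> C)
    p (@continuous_snd2 _ _ p) (@continuous_circle rad _)).
- move=> t s /andP[t0 t1] _; apply: v0; rewrite cmodM cmod_circle// cmod_real.
  by rewrite ger0_norm// ler_piMl.
- by move=> _; rewrite !mul0r.
exists th; split=> //.
- by apply: pth; rewrite ?lexx ?ler01// => t _; rewrite circle01.
- by move=> s sI; have := hth s sI; rewrite mul1r.
Qed.

Lemma has_periodic_arg_prod (rs : seq R[i]) rad : 0 < rad ->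
  all (fun a => cmod a < rad) rs ->
  has_periodic_arg (fun s => \prod_(a <- rs) (1 - a / circle rad s)).
Proof.
move=> rad0; elim: rs => [_|a rs IH /= /andP[ha hrs]].
  apply: has_periodic_arg_Re_gt0; rewrite ?big_nil//.
    by move=> s; under eq_fun do rewrite big_nil; exact: cvg_cst.
  by move=> s _; rewrite big_nil ltr01.
apply: (eq_has_periodic_arg (w1 := fun s =>
  (1 - a / circle rad s) * \prod_(b <- rs) (1 - b / circle rad s))).
  by move=> s _; rewrite big_cons.
apply: has_periodic_argM; last exact: IH.
have cn0 s : circle rad s != 0 by rewrite -cmod_gt0 cmod_circle// ltW.
apply: has_periodic_arg_Re_gt0; last by rewrite circle01.
  move=> s; apply: (@continuousC_B _ _ s (fun=> 1) (fun s => a / circle rad s)).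
    exact: cvg_cst.
  apply: (@continuousC_M _ _ s (fun=> a) (fun s => (circle rad s)^-1)).
    exact: cvg_cst.
  apply: (@continuousC_V _ _ s (fun s => circle rad s)) => //.
  exact: continuous_circle.
move=> s _; apply: Re_gt0_near1.
rewrite addrAC subrr add0r cmodN cmodM cmodV cmod_circle ?(ltW rad0)//.
by rewrite ltr_pdivrMr// mul1r.
Qed.

(** Topological argument principle: on the circle the factor [v] contributes no
    winding, each root inside contributes one turn. *)
Lemma disc_no_root (u v : R[i] -> R[i]) (rs : seq R[i]) rad : 0 < rad ->
  continuous (v : C -> C) -> (forall z, cmod z <= rad -> v z != 0) ->
  all (fun a => cmod a < rad) rs ->
  (forall z, cmod z = rad -> u z = \prod_(a <- rs) (z - a) * v z) ->
  has_periodic_arg (fun s => u (circle rad s)) -> rs = [::].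
Proof.
move=> rad0 cv v0 hrs uE hu.
have rad0' := ltW rad0.
case: (posnP (size rs)) => [/size0nil//|k0]; exfalso.
have cn0 s : circle rad s != 0 by rewrite -cmod_gt0 cmod_circle.
apply: (no_periodic_arg_cisX k0 (R := R)).
apply: (eq_has_periodic_arg (w1 := fun s => ((rad ^- size rs)%:C *
   (u (circle rad s) * (v (circle rad s))^-1)) *
   (\prod_(a <- rs) (1 - a / circle rad s))^-1)); last first.
  apply: has_periodic_argM; last exact/has_periodic_argV/has_periodic_arg_prod.
  apply: has_periodic_argM; last first.
    by apply: has_periodic_argM => //; exact/has_periodic_argV/disc_periodic_arg.
  apply: has_periodic_arg_Re_gt0 => //=; first by move=> s; exact: cvg_cst.
  by move=> s _; rewrite invr_gt0 exprn_gt0.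
move=> s _; rewrite uE ?cmod_circle// mulfK ?v0 ?cmod_circle//.
have -> : \prod_(a <- rs) (circle rad s - a) =
    circle rad s ^+ size rs * \prod_(a <- rs) (1 - a / circle rad s).
  elim: (rs) => [|a r IH]; first by rewrite !big_nil expr0 mulr1.
  rewrite !big_cons IH/= exprS mulrACA; congr (_ * _).
  by field.
have pn0 : \prod_(a <- rs) (1 - a / circle rad s) != 0.
  rewrite prodf_seq_neq0; apply/allP => a /(allP hrs) ha; apply/implyP => _.
  rewrite subr_eq0; apply: contraTneq ha => h1; rewrite -leNgt.
  have /(congr1 (@cmod R)) : a = circle rad s by rewrite -[LHS](divfK (cn0 s)) -h1 mul1r.
  by rewrite cmod_circle// => ->.
rewrite -mulrA mulfK// /circle exprMn [LHS]mulrA.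
have -> : (rad ^- size rs)%:C * rad%:C ^+ size rs = 1.
  by rewrite fmorphV rmorphXn/= mulVf// expf_neq0// -cmod_gt0 cmod_real normr_gt0 gt_eqF.
by rewrite mul1r.
Qed.

End Circle.

(** * Polynomial approximation on plane arcs *)

Section PolyApprox.
Variable R : realType.
Implicit Types (E : set R[i]) (z w b : R[i]) (h q : R[i] -> R[i]) (p : {poly R[i]}).

Definition poly_approx E h := forall e : R, 0 < e ->
  exists p, forall z, E z -> cmod (h z - p.[z]) < e.

Definition plane_bounded E := exists2 M : R, 0 < M & forall z, E z -> cmod z <= M.

Lemma poly_approx_poly E p : poly_approx E (fun z => p.[z]).
Proof. by move=> e e0; exists p => z _; rewrite subrr cmod0. Qed.

Lemma eq_poly_approx E h q : (forall z, E z -> h z = q z) ->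
  poly_approx E h -> poly_approx E q.
Proof. by move=> hq hh e /hh[p hp]; exists p => z Ez; rewrite -hq// hp. Qed.

Lemma poly_approxD E h q : poly_approx E h -> poly_approx E q ->
  poly_approx E (fun z => h z + q z).
Proof.
move=> hh hq e e0; have e2 : 0 < e / 2 by rewrite divr_gt0.
have [p1 H1] := hh _ e2; have [p2 H2] := hq _ e2.
exists (p1 + p2) => z Ez; rewrite hornerD opprD addrACA (splitr e).
by rewrite (le_lt_trans (ler_cmodD _ _))// ltrD ?H1 ?H2.
Qed.

Lemma poly_bounded E p : plane_bounded E ->
  exists2 M : R, 0 < M & forall z, E z -> cmod p.[z] <= M.
Proof.
move=> [M M0 EM]; elim/poly_ind: p => [|p c [N N0 IH]].
  by exists 1 => // z _; rewrite horner0 cmod0.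
exists (N * M + cmod c + 1); first by rewrite ltr_wpDl ?addr_ge0 ?mulr_ge0 ?cmod_ge0// ltW.
move=> z Ez; rewrite hornerMXaddC (le_trans (ler_cmodD _ _))// cmodM.
have := ler_pM (cmod_ge0 _) (cmod_ge0 _) (IH _ Ez) (EM _ Ez).
by lra.
Qed.

Lemma poly_approx_bounded E h : plane_bounded E -> poly_approx E h ->
  exists2 M : R, 0 < M & forall z, E z -> cmod (h z) <= M.
Proof.
move=> bE /(_ 1 ltr01)[p hp]; have [M M0 HM] := poly_bounded p bE.
exists (1 + M); first by rewrite addr_gt0.
move=> z Ez; rewrite -[h z](subrK p.[z]) (le_trans (ler_cmodD _ _))//.
by rewrite lerD ?HM// ltW// hp.
Qed.

Lemma poly_approxM E h q : plane_bounded E ->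
  poly_approx E h -> poly_approx E q -> poly_approx E (fun z => h z * q z).
Proof.
move=> bE hh hq e e0.
have [M M0 HM] := poly_approx_bounded bE hh.
have [p2 H2] := hq (e / 2 / M) (divr_gt0 (divr_gt0 e0 (ltr0Sn _ 1)) M0).
have [N N0 HN] := poly_bounded p2 bE.
have [p1 H1] := hh (e / 2 / N) (divr_gt0 (divr_gt0 e0 (ltr0Sn _ 1)) N0).
exists (p1 * p2) => z Ez; rewrite hornerM.
have -> : h z * q z - p1.[z] * p2.[z] =
  h z * (q z - p2.[z]) + (h z - p1.[z]) * p2.[z] by ring.
rewrite (splitr e) (le_lt_trans (ler_cmodD _ _))// !cmodM ltrD//.
  rewrite (@le_lt_trans _ _ (M * cmod (q z - p2.[z])))//.
    exact: (ler_wpM2r (cmod_ge0 _) (HM _ Ez)).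
  by rewrite mulrC -ltr_pdivlMr// H2.
rewrite (@le_lt_trans _ _ (cmod (h z - p1.[z]) * N))//.
  exact: (ler_wpM2l (cmod_ge0 _) (HN _ Ez)).
by rewrite -ltr_pdivlMr// H1.
Qed.

Lemma poly_approxZ E (c : R[i]) h : plane_bounded E -> poly_approx E h ->
  poly_approx E (fun z => c * h z).
Proof.
move=> bE hh; apply: (@poly_approxM _ (fun=> c)) => //.
by apply: eq_poly_approx (poly_approx_poly E c%:P) => z _; rewrite hornerC.
Qed.

Lemma poly_approx_lim E h : (forall e : R, 0 < e -> exists2 q, poly_approx E q &
  forall z, E z -> cmod (h z - q z) <= e) -> poly_approx E h.
Proof.
move=> H e e0; have e2 : 0 < e / 2 by rewrite divr_gt0.
have [q hq hhq] := H _ e2; have [p hp] := hq _ e2.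
exists p => z Ez; rewrite -[h z](subrK (q z)) -addrA (splitr e).
by rewrite (le_lt_trans (ler_cmodD _ _))// ler_ltD ?hhq ?hp.
Qed.

Lemma poly_approx_prod E (rs : seq R[i]) (F : R[i] -> R[i] -> R[i]) :
  plane_bounded E -> (forall b, b \in rs -> poly_approx E (F b)) ->
  poly_approx E (fun z => \prod_(b <- rs) F b z).
Proof.
move=> bE; elim: rs => [_|b rs IH Frs].
  by apply: eq_poly_approx (poly_approx_poly E 1) => z _; rewrite big_nil hornerC.
apply: (@eq_poly_approx _ (fun z => F b z * \prod_(b <- rs) F b z)).
  by move=> z _; rewrite big_cons.
apply: poly_approxM => //; first by apply: Frs; rewrite mem_head.
by apply: IH => b' b'rs; apply: Frs; rewrite inE b'rs orbT.
Qed.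

(** The Neumann series of [1 / (1 - q)] converges uniformly on [E]. *)
Lemma poly_approx_neumann E q : plane_bounded E -> poly_approx E q ->
  (forall z, E z -> cmod (q z) <= 1 / 2) ->
  poly_approx E (fun z => (1 - q z)^-1).
Proof.
move=> bE hq q2; apply: poly_approx_lim => e e0.
pose n := Num.truncn e^-1.
have ne : e^-1 < n.+1%:R by exact: truncnS_gt.
have ne2 : e^-1 < 2 ^+ n.+1.
  rewrite (lt_le_trans ne)// -natrX ler_nat ltnW// ltn_expl//.
exists (fun z => \sum_(k < n.+2) q z ^+ k).
  elim: (n.+2) => [|m IH].
    by apply: eq_poly_approx (poly_approx_poly E 0) => z _; rewrite big_ord0 hornerC.
  apply: (@eq_poly_approx _ (fun z => \sum_(k < m) q z ^+ k + q z ^+ m)).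
    by move=> z _; rewrite big_ord_recr.
  apply: poly_approxD => //; elim: {IH} m => [|m IH].
    by apply: eq_poly_approx (poly_approx_poly E 1) => z _; rewrite hornerC.
  apply: (@eq_poly_approx _ (fun z => q z * q z ^+ m)).
    by move=> z _; rewrite exprS.
  exact: poly_approxM.
move=> z Ez; have qz := q2 _ Ez.
have c1 : 1 / 2 <= cmod (1 - q z).
  by have := ler_cmodB 1 (q z); rewrite cmod1; lra.
have n1 : 1 - q z != 0 by rewrite -cmod_gt0; apply: lt_le_trans c1.
have -> : (1 - q z)^-1 - \sum_(k < n.+2) q z ^+ k = q z ^+ n.+2 / (1 - q z).
  apply: (mulIf n1); rewrite mulrBl mulVf// divfK//.
  have := subrX1 (q z) n.+2; rewrite -[q z - 1]opprB mulNr [X in _ = - X]mulrC => /eqP.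
  rewrite -eqr_oppLR opprB => /eqP <-; ring.
rewrite cmodM cmodV cmodX.
have h1 : (cmod (1 - q z))^-1 <= 2.
  by rewrite -[leRHS]invrK lef_pV2 ?posrE ?invr_gt0 ?cmod_gt0//; lra.
have h2 : cmod (q z) ^+ n.+2 <= (1 / 2) ^+ n.+2 by apply: lerXn2r => //; rewrite nnegrE ?cmod_ge0//; lra.
rewrite (@le_trans _ _ ((1 / 2) ^+ n.+2 * 2))//.
  by rewrite ler_pM ?exprn_ge0 ?invr_ge0 ?cmod_ge0.
rewrite exprS mulrAC (_ : 1 / 2 * 2 = 1) ?mul1r; last by field.
by rewrite exprVn -[leRHS]invrK lef_pV2 ?posrE ?invr_gt0 ?exprn_gt0 ?ltW.
Qed.

(** Expanding [(z - b)^-1] in powers of [(b - b0) / (z - b0)]: a pole can be moved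
    by half its distance to [E]. *)
Lemma poly_approx_push E b0 b (d : R) : plane_bounded E -> 0 < d ->
  (forall z, E z -> d <= cmod (z - b0)) -> cmod (b - b0) <= d / 2 ->
  poly_approx E (fun z => (z - b0)^-1) -> poly_approx E (fun z => (z - b)^-1).
Proof.
move=> bE d0 dE bb0 h0.
have zn z : E z -> z - b0 != 0 by move=> /dE dz; rewrite -cmod_gt0; apply: lt_le_trans dz.
apply: (@eq_poly_approx _
    (fun z => (z - b0)^-1 * (1 - (b - b0) * (z - b0)^-1)^-1)).
  move=> z Ez; rewrite -invfM mulrBr mulr1 mulrCA divff ?zn// mulr1.
  by congr (_^-1); ring.
apply: poly_approxM => //; apply: poly_approx_neumann => //.
  exact: poly_approxZ.
move=> z Ez; rewrite cmodM cmodV ler_pdivrMr ?cmod_gt0 ?zn//.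
by have := dE _ Ez; lra.
Qed.

Lemma poly_approx_far E b (M : R) : 0 < M -> (forall z, E z -> cmod z <= M) ->
  2 * M <= cmod b -> poly_approx E (fun z => (z - b)^-1).
Proof.
move=> M0 EM Mb.
have bE : plane_bounded E by exists M.
have b0 : b != 0 by rewrite -cmod_gt0; lra.
apply: (@eq_poly_approx _ (fun z => - b^-1 * (1 - b^-1 * z)^-1)).
  move=> z Ez; rewrite -invrN -invfM; congr (_^-1).
  by rewrite mulrBr mulr1 mulNr mulrA divff// mul1r opprK addrC.
apply: poly_approxZ => //; apply: poly_approx_neumann => //.
  apply: poly_approxZ => //.
  by apply: eq_poly_approx (poly_approx_poly E 'X) => z _; rewrite hornerX.
move=> z Ez; rewrite cmodM cmodV mulrC ler_pdivrMr ?cmod_gt0//.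
by have := EM _ Ez; lra.
Qed.

End PolyApprox.

Section PlaneArc.
Variable R : realType.
Local Notation C := (R[i]^o).
Implicit Types (s t d e : R).

Lemma positive_lower_bound (m : R -> R) : continuous m ->
  (forall s, 0 <= s <= 1 -> 0 < m s) ->
  exists2 d, 0 < d & forall s, 0 <= s <= 1 -> d <= m s.
Proof.
move=> cm pm; have [] := @EVT_min R m 0 1 ler01.
  exact: continuous_subspaceT.
move=> c; rewrite in_itv/= => cI hc; exists (m c); first exact: pm.
by move=> s sI; apply: hc; rewrite in_itv.
Qed.

Variable gamma : R -> R[i].
Hypothesis gamma_cont : continuous (gamma : R -> C).
Hypothesis gamma_inj : forall s t, 0 <= s <= 1 -> 0 <= t <= 1 ->
  gamma s = gamma t -> s = t.

Definition trace : set R[i] := [set gamma s | s in [set s | 0 <= s <= 1]].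

Lemma trace_bounded : plane_bounded trace.
Proof.
have p1 s : 0 < 1 + cmod (gamma s) by have := cmod_ge0 (gamma s); lra.
have [||d d0 hd] := @positive_lower_bound (fun s => (1 + cmod (gamma s))^-1).
- move=> s; apply: cvgV; first by rewrite gt_eqF.
  apply: cvgD; first exact: cvg_cst.
  exact: (continuousC_cmod (@gamma_cont s)).
- by move=> s _; rewrite invr_gt0.
exists d^-1; rewrite ?invr_gt0// => _ [s sI <-].
rewrite (@le_trans _ _ (1 + cmod (gamma s)))//; first by rewrite lerDr.
by rewrite -[leLHS]invrK lef_pV2 ?posrE ?invr_gt0 ?p1// hd.
Qed.

Lemma trace_dist (b : R[i]) : ~ trace b ->
  exists2 d, 0 < d & forall z, trace z -> d <= cmod (z - b).
Proof.
move=> Eb; have [||d d0 hd] := @positive_lower_bound (fun s => cmod (gamma s - b)).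
- move=> s; apply: continuousC_cmod; apply: continuousC_B; first exact: gamma_cont.
  exact: cvg_cst.
- move=> s sI; rewrite cmod_gt0 subr_eq0; apply/eqP => h.
  by apply: Eb; exists s.
by exists d => // _ [s sI <-]; exact: hd.
Qed.

(** The parameters at distance at least [e] from [s0] form a compact set, on which
    [gamma] keeps away from [gamma s0]. The second summand of the minimised
    function is positive on the other parameters and spares this restriction. *)
Lemma arc_parameter_continuous (s0 e : R) : 0 <= s0 <= 1 -> 0 < e ->
  exists2 d, 0 < d & forall s, 0 <= s <= 1 ->
    cmod (gamma s - gamma s0) < d -> `|s - s0| < e.
Proof.
move=> s0I e0.
have [||d d0 hd] := @positive_lower_bound
    (fun s => cmod (gamma s - gamma s0) + Num.max 0 (e - `|s - s0|)).
- move=> s; apply: cvgD.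
    apply: continuousC_cmod; apply: continuousC_B; first exact: gamma_cont.
    exact: cvg_cst.
  apply: (@continuous_max R _ (fun=> 0) (fun s => e - `|s - s0|) s).
    exact: cvg_cst.
  apply: cvgB; first exact: cvg_cst.
  apply: (@continuous_compose _ _ _ (fun s => s - s0) (fun x : R => `|x|)).
    by apply: cvgB; [exact: cvg_id|exact: cvg_cst].
  exact: norm_continuous.
- move=> s sI; have [<-|ns] := eqVneq s s0.
    by rewrite !subrr normr0 subr0 cmod0 add0r lt_max e0 orbT.
  rewrite ltr_pwDl ?le_max ?lexx// cmod_gt0 subr_eq0.
  by apply: contra_neq ns => h; exact: gamma_inj.
exists d => // s sI hs; rewrite ltNge; apply/negP => es.
have := hd s sI; rewrite (max_l (_ : e - `|s - s0| <= 0)) ?subr_le0//.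
by rewrite addr0 leNgt hs.
Qed.

Definition arc_parameter (z : R[i]) : R :=
  xget 0 [set s | 0 <= s <= 1 /\ gamma s = z].

Lemma arc_parameterK s : 0 <= s <= 1 -> arc_parameter (gamma s) = s.
Proof.
move=> sI; rewrite /arc_parameter; case: xgetP => [t -> [tI]|].
  exact: gamma_inj.
by move=> /(_ s)[].
Qed.

Lemma trace_angle (b : R[i]) : ~ trace b ->
  exists2 theta : R -> R, continuous theta &
    forall s, 0 <= s <= 1 ->
      gamma s - b = (cmod (gamma s - b))%:C * cis (theta s).
Proof.
move=> Eb; have [|t s /andP[t0 t1] /andP[s0 s1]|s sI|th [cth hth _]] :=
    @arg_lift R (fun t s => gamma (t * s) - b).
- move=> p; apply: continuousC_B; last exact: cvg_cst.
  have h : {for p, continuous (fun q : R * R => q.1 * q.2)}.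
    by apply: cvgM; [exact: continuous_fst2|exact: continuous_snd2].
  exact: (@continuous_compose _ _ _ _ (gamma : R -> C) p h (@gamma_cont _)).
- rewrite subr_eq0; apply/eqP => h; apply: Eb; exists (t * s) => //=.
  by rewrite mulr_ge0// mulr_ile1.
- by rewrite !mul0r.
exists th => // s sI.
by have := hth s sI; rewrite mul1r.
Qed.

(** Tietze's theorem on the plane, viewed as [R * R] to have a pseudometric with
    real radii; those of [R[i]^o] are complex. *)
Lemma tietze_trace (theta : R -> R) : continuous theta ->
  exists2 g : R[i] -> R, continuous (g : C -> R) &
    forall s, 0 <= s <= 1 -> g (gamma s) = theta s.
Proof.
move=> cth.
pose A : set (R^o * R^o) := [set p | trace (p.1 +i* p.2)].
pose f (p : R^o * R^o) : R^o := theta (arc_parameter (p.1 +i* p.2)).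
have cpair : continuous (fun p : R^o * R^o => (p.1 +i* p.2 : C)).
  move=> p; apply: (@continuousC_pair _ _ p (fun p : R^o * R^o => p.1)
     (fun p : R^o * R^o => p.2)); [exact: continuous_fst2|exact: continuous_snd2].
have cA : closed A.
  rewrite -openC openE => p /= /trace_dist[d d0 hd]; rewrite /interior.
  have /continuous_cmodP/(_ d d0) := cpair p.
  by apply: filterS => q /= hq /hd; rewrite leNgt hq.
have cf : {within A, continuous f}.
  apply/subspace_continuousP => p [s0 s0I hs0].
  apply/cvgrPdist_lt => e e0.
  have /continuous_realP/(_ e e0)/nbhs_ballP[d1 /= d10 hd1] := cth s0.
  have [d d0 hd] := arc_parameter_continuous s0I d10.
  rewrite near_withinE; have /continuous_cmodP/(_ d d0) := cpair p.
  apply: filterS => q /= hq [s sI hs]; rewrite /f /from_subspace -hs0 -hs !arc_parameterK// distrC.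
  by apply: hd1; rewrite /ball/= distrC; apply: hd => //; rewrite hs hs0.
have pth s : 0 < 1 + `|theta s| by have := normr_ge0 (theta s); lra.
have [||d d0 hd] := @positive_lower_bound (fun s => (1 + `|theta s|)^-1).
- move=> s; apply: cvgV; first by rewrite gt_eqF.
  apply: cvgD; first exact: cvg_cst.
  exact: (continuous_compose (cth s) (@norm_continuous _ _ _)).
- by move=> s _; rewrite invr_gt0.
have fd p : A p -> `|f p| <= d^-1.
  move=> [s sI hs]; rewrite /f -hs arc_parameterK//.
  rewrite (@le_trans _ _ (1 + `|theta s|))//; first by rewrite lerDr.
  by rewrite -[leLHS]invrK lef_pV2 ?posrE ?invr_gt0 ?pth// hd.
have d'0 : 0 < d^-1 by rewrite invr_gt0.
have [g [fg cg _]] := @continuous_bounded_extension _ R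
  (@pseudometric_normal R _) A cA f d^-1 d'0 cf fd.
exists (fun z => g (complex.Re z, complex.Im z)).
  move=> z.
  have h : {for z, continuous (fun z : C => (complex.Re z : R^o, complex.Im z : R^o))}.
    apply: continuous_pair2.
      by apply: (@continuousC_Re _ _ z (fun z : C => z)); exact: cvg_id.
    by apply: (@continuousC_Im _ _ z (fun z : C => z)); exact: cvg_id.
  exact: (@continuous_compose _ _ _ _ (g : _ -> R) z h (cg _)).
move=> s sI; rewrite -fg.
  have -> : f (complex.Re (gamma s), complex.Im (gamma s)) = theta (arc_parameter (gamma s)).
    by rewrite /f/=; case: (gamma s).
  by rewrite arc_parameterK.
by rewrite inE /A/=; exists s => //; case: (gamma s).
Qed.

End PlaneArc.

Section ArcComplement.
Variable R : realType.
Local Notation C := (R[i]^o).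
Implicit Types (s t d e : R).
Variable gamma : R -> R[i].
Hypothesis gamma_cont : continuous (gamma : R -> C).
Hypothesis gamma_inj : forall s t, 0 <= s <= 1 -> 0 <= t <= 1 ->
  gamma s = gamma t -> s = t.
Local Notation E := (trace gamma).

(** Poles can be pushed to infinity because an arc does not separate the plane.
    The poles [b] that resist form a bounded open set [U] whose boundary lies on
    the arc. If [b0] were in [U], replacing the argument of [w - b0] inside [U]
    by an extension of its argument along the arc would turn [w - b0] into a
    zero-free function on a large disc with the same values on the boundary
    circle. *)
Theorem poly_approx_pole (b0 : R[i]) : ~ E b0 ->
  poly_approx E (fun z => (z - b0)^-1).
Proof.
move=> Eb0; apply: contrapT => nb0.
have bE : plane_bounded E := trace_bounded gamma_cont.
have [M M0 EM] := bE.
pose S := [set b | poly_approx E (fun z => (z - b)^-1)].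
pose U := [set b | ~ E b /\ ~ S b].
have Ubd b : U b -> cmod b < 2 * M.
  move=> [_ nS]; rewrite ltNge; apply/negP => Mb; apply: nS.
  exact: (poly_approx_far M0 EM Mb).
(* membership in [U] is locally constant off the arc *)
have loc b : ~ E b -> exists2 d, 0 < d & forall w, cmod (w - b) < d ->
    ~ E w /\ (S w <-> S b).
  move=> Eb; have [d d0 hd] := trace_dist gamma_cont Eb.
  exists (d / 4); first by rewrite divr_gt0.
  move=> w hw.
  have hw2 z : E z -> d * 3 / 4 <= cmod (z - w).
    move=> Ez; have := hd z Ez.
    have := ler_cmodD (z - w) (w - b); rewrite addrA subrK; lra.
  split; first by move=> /hw2; rewrite subrr cmod0; lra.
  have d34 : 0 < d * 3 / 4 by lra.
  split.
    apply: (poly_approx_push bE d34 hw2); rewrite cmod_distC; lra.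
  by apply: (poly_approx_push bE d0 hd); lra.
have [d0 d00 hd0] := trace_dist gamma_cont Eb0.
have [theta cth hth] := trace_angle gamma_cont Eb0.
have [g cg hg] := tietze_trace gamma_cont gamma_inj cth.
pose vin (w : R[i]) : R[i] := (Num.max (cmod (w - b0)) d0)%:C * cis (g w).
pose v (w : R[i]) : R[i] := if `[< U w >] then vin w else w - b0.
have csub : continuous ((fun w => w - b0) : C -> C).
  by move=> w; apply: (@continuousC_B _ _ w (fun w : C => w) (fun=> b0)); [exact: cvg_id|exact: continuousC_cst].
have cvin : continuous (vin : C -> C).
  move=> w; apply: (@continuousC_M _ _ w (fun w : C => (Num.max (cmod (w - b0)) d0)%:C)
    (fun w : C => cis (g w))); last exact: (@continuous_cis _ _ (g : C -> R) w (cg w)).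
  apply: (@continuousC_real _ _ w (fun w : C => Num.max (cmod (w - b0)) d0)).
  apply: (@continuous_max R _ (fun w : C => cmod (w - b0)) (fun=> d0) w).
    exact: (continuousC_cmod (csub w)).
  exact: continuous_fun_cst.
have cv : continuous (v : C -> C).
  move=> w; have [[s sI hs]|Ew] := pselect (E w).
    have agree : vin w = w - b0.
      rewrite /vin -hs hg// max_l; first by rewrite -hth.
      by apply: hd0; exists s.
    have vw : v w = w - b0 by rewrite /v; case: ifP.
    apply/continuous_cmodP => e e0; rewrite vw.
    have /continuous_cmodP/(_ e e0) h1 := cvin w; rewrite agree in h1.
    have /continuous_cmodP/(_ e e0) h2 := csub w.
    near=> y; rewrite /v; case: ifP => _; near: y; [exact: h1|exact: h2].
  have [d d1 hd] := loc w Ew.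
  have nw : \forall y \near (w : C), `[< U y >] = `[< U w >].
    apply/nbhs_cmodP; exists d => // y hy; apply: asbool_equiv_eq.
    have [Ey ySw] := hd y hy; split; move=> [_ nS]; split=> //.
      by move=> /ySw.
    by move=> /ySw.
  apply/continuous_cmodP => e e0; rewrite /v; case: ifP => Uw.
    have /continuous_cmodP/(_ e e0) h := cvin w.
    near=> y; rewrite (_ : `[< U y >] = true); first by near: y; exact: h.
    by rewrite -Uw; near: y; exact: nw.
  have /continuous_cmodP/(_ e e0) h := csub w.
  near=> y; rewrite (_ : `[< U y >] = false); first by near: y; exact: h.
  by rewrite -Uw; near: y; exact: nw.
have v0 z : v z != 0.
  rewrite /v; case: asboolP => Uz.
    rewrite -cmod_gt0 cmodM cmod_cis mulr1 cmod_real normr_gt0 gt_eqF//.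
    by rewrite lt_max d00 orbT.
  by rewrite subr_eq0; apply: contra_not_neq Uz => ->.
have rad0 : 0 < 2 * M by lra.
have c1 : continuous ((fun=> 1) : C -> C) by move=> z; exact: continuous_fun_cst.
have n1 (z : R[i]) : cmod z <= 2 * M -> (1 : R[i]) != 0 by rewrite oner_neq0.
have hb : all (fun a => cmod a < 2 * M) [:: b0] by rewrite /= andbT; exact: Ubd.
have hf z : cmod z = 2 * M -> v z = \prod_(a <- [:: b0]) (z - a) * 1.
  by move=> hz; rewrite big_seq1 mulr1 /v asboolF// => /Ubd; rewrite hz ltxx.
have ha := disc_periodic_arg (ltW rad0) cv (fun z _ => v0 z).
by have := disc_no_root rad0 c1 n1 hb hf ha.
Unshelve. all: by end_near. Qed.

(** The roots of the denominator lie off the arc, so its inverse is a product of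
    the simple poles of [poly_approx_pole]. *)
Lemma poly_approx_rational (h : R[i] -> R[i]) (Q S : {poly R[i]}) :
  (forall z, E z -> S.[z] != 0 /\ h z = Q.[z] / S.[z]) -> poly_approx E h.
Proof.
move=> H.
have bE : plane_bounded E := trace_bounded gamma_cont.
apply: (@eq_poly_approx _ _ (fun z => Q.[z] * (S.[z])^-1)).
  by move=> z /H[_ ->].
apply: poly_approxM => //; first exact: poly_approx_poly.
have [rs Srs] := closed_field_poly_normal S.
have SE z : S.[z] = lead_coef S * \prod_(b <- rs) (z - b).
  rewrite {1}Srs hornerZ horner_prod; congr (_ * _).
  by apply: eq_bigr => b _; rewrite hornerXsubC.
apply: (@eq_poly_approx _ _ (fun z => (lead_coef S)^-1 * \prod_(b <- rs) (z - b)^-1)).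
  by move=> z _; rewrite SE invfM prodfV.
apply: poly_approxZ => //; apply: poly_approx_prod => // b brs.
apply: poly_approx_pole => Eb; have [] := H b Eb.
by rewrite SE (big_rem b brs)/= subrr mul0r mulr0 eqxx.
Qed.

End ArcComplement.

(** * Geometrically convergent sequences *)

Section Geometric.
Variable R : realType.
Local Notation C := (R[i]^o).
Implicit Types (k M e : R).

Lemma geometric_small k M e : 0 <= k < 1 -> 0 < e ->
  exists N, forall n, (N <= n)%N -> M * k ^+ n < e.
Proof.
move=> /andP[k0 k1] e0.
have /cvgrPdist_lt h : (fun n => M * k ^+ n) @ \oo --> (M * 0 : R).
  by apply: cvgMl_tmp; apply: cvg_expr; rewrite ger0_norm.
have [N _ hN] := h e e0; exists N => n Nn.
have := hN n Nn; rewrite mulr0 sub0r normrN; exact: le_lt_trans (ler_norm _).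
Qed.

(** With [c = M / (1 - k)] the sequence [a n - c * k ^+ n] increases, the sequence
    [a n + c * k ^+ n] decreases, and the limit is the supremum of the former. *)
Lemma real_geometric_limit (a : nat -> R) k M : 0 <= k < 1 -> 0 <= M ->
  (forall n, `|a n.+1 - a n| <= M * k ^+ n) ->
  exists l, forall n, `|a n - l| <= M / (1 - k) * k ^+ n.
Proof.
move=> /andP[k0 k1] M0 ha.
pose c := M / (1 - k).
have k1' : 0 < 1 - k by rewrite subr_gt0.
have cE : M = c - c * k by rewrite /c; field; rewrite gt_eqF.
have c0 : 0 <= c by rewrite divr_ge0// ltW.
have step n : `|a n.+1 - a n| <= c * k ^+ n - c * k ^+ n.+1.
  have <- : M * k ^+ n = c * k ^+ n - c * k ^+ n.+1 by rewrite cE exprS; ring.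
  exact: ha.
pose b n := a n - c * k ^+ n; pose d n := a n + c * k ^+ n.
have bS n : b n <= b n.+1.
  by have := step n; rewrite ler_norml /b => /andP[]; lra.
have dS n : d n.+1 <= d n.
  by have := step n; rewrite ler_norml /d => /andP[]; lra.
have bm n j : b n <= b (n + j)%N.
  by elim: j => [|j IH]; rewrite ?addn0 // addnS; apply: le_trans IH _.
have dm n j : d (n + j)%N <= d n.
  by elim: j => [|j IH]; rewrite ?addn0 // addnS; apply: le_trans (dS _) IH.
have bd n j : b n <= d j.
  rewrite (le_trans (bm n j))// (le_trans _ (dm j n))// [(j + n)%N]addnC.
  have : 0 <= c * k ^+ (n + j) by rewrite mulr_ge0 ?exprn_ge0.
  by rewrite /b /d; lra.
pose B := [set b n | n in [set: nat]].
have hB : has_sup B.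
  split; first by exists (b 0%N); exists 0%N.
  by exists (d 0%N) => _ [n _ <-].
exists (sup B) => n; rewrite ler_norml; apply/andP; split.
  rewrite lerBrDr addrC lerBlDr.
  by apply: ge_sup; [exact: hB.1|move=> _ [m _ <-]; exact: bd].
rewrite lerBlDr addrC -lerBlDr.
by apply: ub_le_sup; [exact: hB.2|exists n].
Qed.

Lemma geometric_limit (a : nat -> R[i]) k M : 0 <= k < 1 -> 0 <= M ->
  (forall n, cmod (a n.+1 - a n) <= M * k ^+ n) ->
  exists l, forall n, cmod (a n - l) <= 2 * (M / (1 - k)) * k ^+ n.
Proof.
move=> hk M0 ha.
have [x hx] := @real_geometric_limit (fun n => complex.Re (a n)) k M hk M0
  (fun n => le_trans (eq_ind _ (fun u => `|u| <= _) (normr_Re_le (a n.+1 - a n)) _ (raddfB _ _ _)) (ha n)).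
have [y hy] := @real_geometric_limit (fun n => complex.Im (a n)) k M hk M0
  (fun n => le_trans (eq_ind _ (fun u => `|u| <= _) (normr_Im_le (a n.+1 - a n)) _ (raddfB _ _ _)) (ha n)).
exists (x +i* y) => n; rewrite (le_trans (cmod_le_ReIm _))// !raddfB/=.
by have := hx n; have := hy n; lra.
Qed.

Lemma continuous_geometric_limit (T : topologicalType) (g : nat -> T -> R[i])
    (h : T -> R[i]) k M : 0 <= k < 1 ->
  (forall n, continuous (g n : T -> C)) ->
  (forall n x, cmod (g n x - h x) <= M * k ^+ n) -> continuous (h : T -> C).
Proof.
move=> hk cg gh x; apply/continuous_cmodP => e e0.
have e3 : 0 < e / 3 by rewrite divr_gt0.
have [N /(_ N (leqnn N)) hN] := geometric_small M hk e3.
have /continuous_cmodP/(_ _ e3) := cg N x.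
apply: filterS => y hy.
have -> : h y - h x = (h y - g N y) + ((g N y - g N x) + (g N x - h x)) by ring.
have h1 := le_lt_trans (gh N y) hN; have h2 := le_lt_trans (gh N x) hN.
have := ler_cmodD (h y - g N y) ((g N y - g N x) + (g N x - h x)).
have := ler_cmodD (g N y - g N x) (g N x - h x).
by rewrite (cmod_distC (h y)); lra.
Qed.

End Geometric.

(** * A self-similar arc *)

Section FractalArc.
Variable R : realType.
Local Notation C := (R[i]^o).
Implicit Types (s t : R) (z w : R[i]) (g h : R -> R[i]).

(** Scaling by 3/5 and turning by a right angle. Because of the turn two copies of
    a rectangle whose sides have a ratio near [sqrt 2] can be stacked inside it as
    long as the scale is below [1 / sqrt 2]. A scale above 1/2 is what makes the
    potential of the limit measure continuous. *)
Definition twist : R[i] := 0 +i* (3 / 5).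
Definition center_lo : R[i] := 0 +i* (-1).
Definition center_hi : R[i] := 0 +i* 1.
(** The path enters the cell [[-3/2, 3/2] x [-2, 2]] at its upper left corner and
    leaves it at the lower right one; after the turn these become the lower left
    and upper right corners of a child, so the two children can be traversed from
    bottom to top. *)
Definition port_in : R[i] := (- (3 / 2)) +i* 2.
Definition port_out : R[i] := 3 / 2 +i* (- 2).
Definition lo_in : R[i] := (- (6 / 5)) +i* (- (19 / 10)).
Definition lo_out : R[i] := 6 / 5 +i* (- (1 / 10)).
Definition hi_in : R[i] := (- (6 / 5)) +i* (1 / 10).
Definition hi_out : R[i] := 6 / 5 +i* (19 / 10).

Lemma lo_inE : center_lo + twist * port_in = lo_in.
Proof. by rewrite /center_lo /twist /port_in /lo_in; simpc; congr (_ +i* _); field. Qed.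
Lemma lo_outE : center_lo + twist * port_out = lo_out.
Proof. by rewrite /center_lo /twist /port_out /lo_out; simpc; congr (_ +i* _); field. Qed.
Lemma hi_inE : center_hi + twist * port_in = hi_in.
Proof. by rewrite /center_hi /twist /port_in /hi_in; simpc; congr (_ +i* _); field. Qed.
Lemma hi_outE : center_hi + twist * port_out = hi_out.
Proof. by rewrite /center_hi /twist /port_out /hi_out; simpc; congr (_ +i* _); field. Qed.

Lemma cmod_twist : cmod twist = 3 / 5.
Proof. by rewrite cmodE/= expr0n add0r sqrtr_sqr ger0_norm// divr_ge0. Qed.

Lemma twist_neq0 : twist != 0.
Proof. by rewrite -cmod_gt0 cmod_twist divr_gt0. Qed.

(** Written as a sum of increments, so that continuity is immediate; a path is
    extended to the line by its end points. *)
Definition refine g s : R[i] :=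
  port_in + (clamp (5 * s))%:C * (lo_in - port_in)
  + twist * (g (5 * s - 1) - port_in)
  + (clamp (5 * s - 2))%:C * (hi_in - lo_out)
  + twist * (g (5 * s - 3) - port_in)
  + (clamp (5 * s - 4))%:C * (port_out - hi_out).

Definition joins_ports g :=
  (forall s, s <= 0 -> g s = port_in) /\ (forall s, 1 <= s -> g s = port_out).

Section pieces.
Variable g : R -> R[i].
Hypothesis gp : joins_ports g.

Lemma refine1 s : s <= 1 / 5 ->
  refine g s = port_in + (clamp (5 * s))%:C * (lo_in - port_in).
Proof.
move=> h; rewrite /refine (gp.1 (5 * s - 1)); last by lra.
rewrite (gp.1 (5 * s - 3)); last by lra.
rewrite (@clamp_le0 _ (5 * s - 2)) ?(@clamp_le0 _ (5 * s - 4)); [|lra|lra].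
by rewrite !rmorph0; ring.
Qed.

Lemma refine2 s : 1 / 5 <= s <= 2 / 5 ->
  refine g s = center_lo + twist * g (5 * s - 1).
Proof.
move=> /andP[h1 h2]; rewrite /refine (gp.1 (5 * s - 3)); last by lra.
rewrite (@clamp_le0 _ (5 * s - 2)) ?(@clamp_le0 _ (5 * s - 4)); [|lra|lra].
rewrite (@clamp_ge1 _ (5 * s)); last by lra.
by rewrite !rmorph0 rmorph1 -lo_inE; ring.
Qed.

Lemma refine3 s : 2 / 5 <= s <= 3 / 5 ->
  refine g s = lo_out + (5 * s - 2)%:C * (hi_in - lo_out).
Proof.
move=> /andP[h1 h2]; rewrite /refine (gp.1 (5 * s - 3)); last by lra.
rewrite (gp.2 (5 * s - 1)); last by lra.
rewrite (@clamp_le0 _ (5 * s - 4)); last by lra.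
rewrite (@clamp_ge1 _ (5 * s)); last by lra.
rewrite (@clamp_id _ (5 * s - 2)); last by apply/andP; lra.
by rewrite !rmorph0 rmorph1 -lo_outE -lo_inE; ring.
Qed.

Lemma refine4 s : 3 / 5 <= s <= 4 / 5 ->
  refine g s = center_hi + twist * g (5 * s - 3).
Proof.
move=> /andP[h1 h2]; rewrite /refine (gp.2 (5 * s - 1)); last by lra.
rewrite (@clamp_le0 _ (5 * s - 4)); last by lra.
rewrite (@clamp_ge1 _ (5 * s)) ?(@clamp_ge1 _ (5 * s - 2)); [|lra|lra].
by rewrite !rmorph0 rmorph1 -lo_outE -lo_inE -hi_inE; ring.
Qed.

Lemma refine5 s : 4 / 5 <= s ->
  refine g s = hi_out + (clamp (5 * s - 4))%:C * (port_out - hi_out).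
Proof.
move=> h1; rewrite /refine (gp.2 (5 * s - 1)); last by lra.
rewrite (gp.2 (5 * s - 3)); last by lra.
rewrite (@clamp_ge1 _ (5 * s)) ?(@clamp_ge1 _ (5 * s - 2)); [|lra|lra].
by rewrite rmorph1 -hi_outE -lo_outE -lo_inE -hi_inE; ring.
Qed.

Lemma joins_ports_refine : joins_ports (refine g).
Proof.
split=> s h.
  by rewrite refine1 ?clamp_le0 ?mul0r ?addr0//; lra.
rewrite refine5; last by lra.
by rewrite clamp_ge1; [rewrite mul1r addrC subrK|lra].
Qed.

End pieces.

Definition cell : set R[i] :=
  [set z | `|complex.Re z| <= 3 / 2 /\ `|complex.Im z| <= 2].

Definition open_cell : set R[i] :=
  [set z | `|complex.Re z| < 3 / 2 /\ `|complex.Im z| < 2].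

Lemma cell_itv z : cell z <->
  (- (3 / 2) <= complex.Re z <= 3 / 2 /\ - 2 <= complex.Im z <= 2).
Proof. by rewrite /cell/= !ler_norml. Qed.

Lemma five_pieces s : [\/ s <= 1 / 5, 1 / 5 <= s <= 2 / 5, 2 / 5 <= s <= 3 / 5 |
  3 / 5 <= s <= 4 / 5 \/ 4 / 5 <= s].
Proof.
have [h1|h1] := leP s (1 / 5); first by constructor 1.
have [h2|h2] := leP s (2 / 5); first by constructor 2; apply/andP; lra.
have [h3|h3] := leP s (3 / 5); first by constructor 3; apply/andP; lra.
constructor 4.
have [h4|h4] := leP s (4 / 5); first by left; apply/andP; lra.
by right; lra.
Qed.

Lemma refine_cell g : joins_ports g -> (forall s, cell (g s)) ->
  forall s, cell (refine g s).
Proof.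
move=> gp gc s; apply/cell_itv; have [h|h|h|[h|h]] := five_pieces s.
- rewrite refine1//; have := clamp_itv (5 * s).
  by rewrite /port_in /lo_in; simpc => /= /andP[]; split; apply/andP; lra.
- rewrite refine2//; have /cell_itv := gc (5 * s - 1); case: (g _) => x y /=.
  by rewrite /center_lo /twist; simpc => /= -[/andP[? ?] /andP[? ?]]; split; apply/andP; lra.
- rewrite refine3// /lo_out /hi_in; simpc => /=; move: h => /andP[? ?].
  by split; apply/andP; lra.
- rewrite refine4//; have /cell_itv := gc (5 * s - 3); case: (g _) => x y /=.
  by rewrite /center_hi /twist; simpc => /= -[/andP[? ?] /andP[? ?]]; split; apply/andP; lra.
- rewrite refine5//; have := clamp_itv (5 * s - 4).
  by rewrite /port_out /hi_out; simpc => /= /andP[]; split; apply/andP; lra.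
Qed.

Lemma continuous_refine g : continuous (g : R -> C) ->
  continuous (refine g : R -> C).
Proof.
move=> cg s.
have aff a : {for s, continuous (fun s => 5 * s - a)}.
  apply: cvgB; last exact: cvg_cst.
  by apply: cvgMl_tmp; exact: cvg_id.
have aff0 : {for s, continuous (fun s => 5 * s)} by apply: cvgMl_tmp; exact: cvg_id.
have ctC (f : R -> R) (c : R[i]) : {for s, continuous f} ->
    {for s, continuous (fun s => (clamp (f s))%:C * c : C)}.
  move=> cf; apply: (@continuousC_M _ _ s (fun s => (clamp (f s))%:C) (fun=> c)).
    apply: (@continuousC_real _ _ s (fun s => clamp (f s))).
    exact: (continuous_compose cf (@continuous_clamp R _)).
  exact: continuous_fun_cst.
have ctg a : {for s, continuous (fun s => twist * (g (5 * s - a) - port_in) : C)}.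
  apply: (@continuousC_M _ _ s (fun=> twist) (fun s => g (5 * s - a) - port_in)).
    exact: continuous_fun_cst.
  apply: (@continuousC_B _ _ s (fun s => g (5 * s - a)) (fun=> port_in)).
    exact: (continuous_compose (aff a) (cg _)).
  exact: continuous_fun_cst.
have ctA := @continuous_fun_cst R C port_in s.
exact: (continuousC_D (continuousC_D (continuousC_D (continuousC_D (continuousC_D
  ctA (ctC _ _ aff0)) (ctg 1)) (ctC _ _ (aff 2))) (ctg 3)) (ctC _ _ (aff 4))).
Qed.

Lemma refine_contract g h (M : R) : joins_ports g -> joins_ports h ->
  (forall s, cmod (g s - h s) <= M) ->
  forall s, cmod (refine g s - refine h s) <= 3 / 5 * M.
Proof.
move=> gp hp gh s.
have key x : cmod (twist * (g x - h x)) <= 3 / 5 * M.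
  by rewrite cmodM cmod_twist ler_wpM2l// divr_ge0.
have -> : refine g s - refine h s =
  twist * (g (5 * s - 1) - h (5 * s - 1)) + twist * (g (5 * s - 3) - h (5 * s - 3)).
  by rewrite /refine; ring.
have [h1|h1] := leP (2 / 5) s.
  by rewrite (gp.2 (5 * s - 1)) ?(hp.2 (5 * s - 1)) ?subrr ?mulr0 ?add0r//; lra.
by rewrite (gp.1 (5 * s - 3)) ?(hp.1 (5 * s - 3)) ?subrr ?mulr0 ?addr0//; lra.
Qed.

Fixpoint path_approx (n : nat) : R -> R[i] :=
  if n is m.+1 then refine (path_approx m)
  else fun s => port_in + (clamp s)%:C * (port_out - port_in).

Lemma path_approxP n : [/\ joins_ports (path_approx n),
  continuous (path_approx n : R -> C) & forall s, cell (path_approx n s)].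
Proof.
elim: n => [|n [jp cn ce]]; last first.
  split; [exact: joins_ports_refine|exact: continuous_refine|exact: refine_cell].
split.
- split=> s h /=; first by rewrite clamp_le0// mul0r addr0.
  by rewrite clamp_ge1// mul1r addrC subrK.
- move=> s; apply: continuousC_D; first exact: continuous_fun_cst.
  apply: (@continuousC_M _ _ s (fun s => (clamp s)%:C) (fun=> port_out - port_in)).
    exact: (@continuousC_real _ _ s (@clamp R) (@continuous_clamp R s)).
  exact: continuous_fun_cst.
- move=> s; apply/cell_itv; have := clamp_itv s.
  by rewrite /= /port_in /port_out; simpc => /= /andP[]; split; apply/andP; lra.
Qed.

Lemma cell_diam z w : cell z -> cell w -> cmod (z - w) <= 7.
Proof.
move=> /cell_itv [/andP[? ?] /andP[? ?]] /cell_itv [/andP[? ?] /andP[? ?]].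
rewrite (le_trans (cmod_le_ReIm _))// !raddfB/=.
have h1 : `|complex.Re z - complex.Re w| <= 3 by rewrite ler_norml; apply/andP; lra.
have h2 : `|complex.Im z - complex.Im w| <= 4 by rewrite ler_norml; apply/andP; lra.
by lra.
Qed.

Lemma fractal_path_exists : exists g, [/\ continuous (g : R -> C),
  joins_ports g, forall s, cell (g s) & forall s, g s = refine g s].
Proof.
have k35 : (0 : R) <= 3 / 5 < (1 : R) by apply/andP; split; lra.
have step n s : cmod (path_approx n.+1 s - path_approx n s) <= 7 * (3 / 5) ^+ n.
  elim: n s => [|n IH] s.
    by rewrite expr0 mulr1 cell_diam//; [have [] := path_approxP 1|have [] := path_approxP 0].
  have [j1 _ _] := path_approxP n.+1; have [j0 _ _] := path_approxP n.
  by have := refine_contract j1 j0 IH s; rewrite exprS mulrCA.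
have [g hg] := choice (fun s => geometric_limit k35 (ler0n _ 7) (step^~ s)).
pose M : R := 2 * (7 / (1 - 3 / 5)).
have {}hg s n : cmod (path_approx n s - g s) <= M * (3 / 5) ^+ n by exact: hg.
have lim0 z : (forall n, cmod z <= M * (3 / 5) ^+ n * 3) -> z = 0.
  move=> hz; apply/eqP; rewrite -cmod_eq0 eq_le cmod_ge0 andbT leNgt.
  apply/negP => z0; have z3 : 0 < cmod z / 3 by rewrite divr_gt0.
  have [N /(_ N (leqnn N))] := geometric_small M k35 z3.
  by have := hz N; lra.
have jg : joins_ports g.
  split=> s h; apply/eqP; rewrite -subr_eq0; apply/eqP/lim0 => n.
    have [[j _] _ _] := path_approxP n.
    by have := hg s n; rewrite j// cmod_distC; have := cmod_ge0 (g s - port_in); lra.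
  have [[_ j] _ _] := path_approxP n.
  by have := hg s n; rewrite j// cmod_distC; have := cmod_ge0 (g s - port_out); lra.
exists g; split=> //.
- apply: (continuous_geometric_limit k35 (g := path_approx) (M := M)) => //.
  by move=> n; have [] := path_approxP n.
- have close (a b : R) (f : R[i] -> R) : (forall z, `|f z| <= cmod z) ->
      (forall z w, f (z - w) = f z - f w) ->
      (forall n s, a <= f (path_approx n s) <= b) -> forall s, a <= f (g s) <= b.
    move=> f1 fB fn s.
    suff F e : 0 < e -> a - e <= f (g s) <= b + e.
      apply/andP; split; apply/ler_addgt0Pr => e /F /andP[]; lra.
    move=> e0; have [N /(_ N (leqnn N)) hN] := geometric_small M k35 e0.
    have := f1 (path_approx N s - g s); rewrite fB => h1.
    have := le_trans h1 (hg s N); rewrite ler_norml => /andP[].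
    by have /andP[] := fn N s; move=> *; apply/andP; lra.
  move=> s; apply/cell_itv; split.
    apply: (close _ _ (@complex.Re R)) => [||n t]; [exact: normr_Re_le|exact: raddfB|].
    by have [_ _ /(_ t)/cell_itv[]] := path_approxP n.
  apply: (close _ _ (@complex.Im R)) => [||n t]; [exact: normr_Im_le|exact: raddfB|].
  by have [_ _ /(_ t)/cell_itv[]] := path_approxP n.
- move=> s; apply/eqP; rewrite -subr_eq0; apply/eqP/lim0 => n.
  have [jn _ _] := path_approxP n.
  have h1 := hg s n.+1; rewrite exprS in h1.
  have h2 := refine_contract jn jg (hg^~ n) s.
  have -> : g s - refine g s = (g s - path_approx n.+1 s) + (refine (path_approx n) s - refine g s).
    by rewrite [path_approx n.+1]/=; ring.
  have := ler_cmodD (g s - path_approx n.+1 s) (refine (path_approx n) s - refine g s).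
  have M0 : 0 <= M by rewrite mulr_ge0// divr_ge0//; lra.
  have : 0 <= M * (3 / 5) ^+ n by rewrite mulr_ge0// exprn_ge0//; lra.
  by rewrite (cmod_distC (g s)); lra.
Qed.

End FractalArc.
Arguments twist {R}.
Arguments center_lo {R}.
Arguments center_hi {R}.
Arguments cell {R}.
Arguments open_cell {R}.

Section SelfSimilar.
Variable R : realType.
Local Notation C := (R[i]^o).
Implicit Types (s t : R) (z w : R[i]).

Variable gamma : R -> R[i].
Hypothesis gamma_ports : joins_ports gamma.
Hypothesis gamma_cell : forall s, cell (gamma s).
Hypothesis gamma_refine : forall s, gamma s = refine gamma s.

Lemma gamma_piece1 s : 0 <= s <= 1 / 5 ->
  gamma s = (- (3 / 2) + 3 / 10 * (5 * s)) +i* (2 - 39 / 10 * (5 * s)).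
Proof.
move=> /andP[h0 h1]; rewrite gamma_refine refine1// clamp_id; last by apply/andP; lra.
by rewrite /port_in /lo_in; simpc; congr (_ +i* _); field.
Qed.

Lemma gamma_piece2 s : 1 / 5 <= s <= 2 / 5 ->
  gamma s = (- (3 / 5 * complex.Im (gamma (5 * s - 1)))) +i*
            (-1 + 3 / 5 * complex.Re (gamma (5 * s - 1))).
Proof.
move=> h; rewrite gamma_refine refine2//; case: (gamma (5 * s - 1)) => x y /=.
by rewrite /center_lo /twist; simpc.
Qed.

Lemma gamma_piece3 s : 2 / 5 <= s <= 3 / 5 ->
  gamma s = (6 / 5 - 12 / 5 * (5 * s - 2)) +i* (- (1 / 10) + 1 / 5 * (5 * s - 2)).
Proof.
move=> h; rewrite gamma_refine refine3//.
by rewrite /lo_out /hi_in; simpc; congr (_ +i* _); field.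
Qed.

Lemma gamma_piece4 s : 3 / 5 <= s <= 4 / 5 ->
  gamma s = (- (3 / 5 * complex.Im (gamma (5 * s - 3)))) +i*
            (1 + 3 / 5 * complex.Re (gamma (5 * s - 3))).
Proof.
move=> h; rewrite gamma_refine refine4//; case: (gamma (5 * s - 3)) => x y /=.
by rewrite /center_hi /twist; simpc.
Qed.

Lemma gamma_piece5 s : 4 / 5 <= s <= 1 ->
  gamma s = (6 / 5 + 3 / 10 * (5 * s - 4)) +i* (19 / 10 - 39 / 10 * (5 * s - 4)).
Proof.
move=> /andP[h0 h1]; rewrite gamma_refine refine5// clamp_id; last by apply/andP; lra.
by rewrite /port_out /hi_out; simpc; congr (_ +i* _); field.
Qed.

(** Distinct pieces only meet in a common end point. *)
Lemma common_piece s t : 0 <= s -> s <= t -> t <= 1 -> gamma s = gamma t ->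
  [\/ t <= 1 / 5, 1 / 5 <= s /\ t <= 2 / 5, 2 / 5 <= s /\ t <= 3 / 5 |
      3 / 5 <= s /\ t <= 4 / 5 \/ 4 / 5 <= s].
Proof.
move=> s0 st t1.
have cx u : - (3 / 2) <= complex.Re (gamma u) <= 3 / 2 by have /cell_itv[] := gamma_cell u.
have cy u : - 2 <= complex.Im (gamma u) <= 2 by have /cell_itv[] := gamma_cell u.
have [hs|hs|hs|[hs|hs]] := five_pieces s; have [ht|ht|ht|[ht|ht]] := five_pieces t;
  try by move: hs ht; rewrite -?(rwP andP) => *; lra.
- by constructor 1.
- have hs' : 0 <= s <= 1 / 5 by apply/andP.
  rewrite (gamma_piece1 hs') (gamma_piece2 ht) => -[e1 e2].
  have := cx (5 * t - 1); have := cy (5 * t - 1); rewrite -!(rwP andP) => *.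
  by constructor 2; move: ht; rewrite -(rwP andP) => *; lra.
- have hs' : 0 <= s <= 1 / 5 by apply/andP.
  rewrite (gamma_piece1 hs') (gamma_piece3 ht) => -[e1 e2].
  by move: ht; rewrite -(rwP andP) => *; lra.
- have hs' : 0 <= s <= 1 / 5 by apply/andP.
  rewrite (gamma_piece1 hs') (gamma_piece4 ht) => -[e1 e2].
  have := cx (5 * t - 3); have := cy (5 * t - 3); rewrite -!(rwP andP) => *.
  by move: ht; rewrite -(rwP andP) => *; lra.
- have hs' : 0 <= s <= 1 / 5 by apply/andP.
  have ht' : 4 / 5 <= t <= 1 by apply/andP.
  by rewrite (gamma_piece1 hs') (gamma_piece5 ht') => -[e1 e2]; lra.
- by constructor 1.
- by constructor 2; move: hs ht; rewrite -!(rwP andP) => *; lra.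
- rewrite (gamma_piece2 hs) (gamma_piece3 ht) => -[e1 e2].
  have := cx (5 * s - 1); rewrite -!(rwP andP) => *.
  by constructor 2; move: hs ht; rewrite -!(rwP andP) => *; lra.
- rewrite (gamma_piece2 hs) (gamma_piece4 ht) => -[e1 e2].
  by have := cx (5 * s - 1); have := cx (5 * t - 3); rewrite -!(rwP andP) => *; lra.
- have ht' : 4 / 5 <= t <= 1 by apply/andP.
  rewrite (gamma_piece2 hs) (gamma_piece5 ht') => -[e1 e2].
  by have := cx (5 * s - 1); have := cy (5 * s - 1); rewrite -!(rwP andP) => *; lra.
- by constructor 2; move: hs ht; rewrite -!(rwP andP) => *; lra.
- by constructor 3; move: hs ht; rewrite -!(rwP andP) => *; lra.
- rewrite (gamma_piece3 hs) (gamma_piece4 ht) => -[e1 e2].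
  have := cx (5 * t - 3); rewrite -!(rwP andP) => *.
  by constructor 4; left; move: hs ht; rewrite -!(rwP andP) => *; lra.
- have ht' : 4 / 5 <= t <= 1 by apply/andP.
  rewrite (gamma_piece3 hs) (gamma_piece5 ht') => -[e1 e2].
  by move: hs; rewrite -!(rwP andP) => *; lra.
- by constructor 3; move: hs ht; rewrite -!(rwP andP) => *; lra.
- by constructor 4; left; move: hs ht; rewrite -!(rwP andP) => *; lra.
- have ht' : 4 / 5 <= t <= 1 by apply/andP.
  rewrite (gamma_piece4 hs) (gamma_piece5 ht') => -[e1 e2].
  have := cx (5 * s - 3); have := cy (5 * s - 3); rewrite -!(rwP andP) => *.
  by constructor 4; left; move: hs; rewrite -!(rwP andP) => *; lra.
- by constructor 4; left; move: ht; rewrite -!(rwP andP) => *; lra.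
- by constructor 4; right.
Qed.

Lemma double_point_blowup s t : 0 <= s -> s <= t -> t <= 1 -> gamma s = gamma t ->
  s = t \/ exists s' t', [/\ 0 <= s', s' <= t', t' <= 1, gamma s' = gamma t' &
    t' - s' = 5 * (t - s)].
Proof.
move=> s0 st t1 e; have := e; have [h|[h1 h2]|[h1 h2]|[[h1 h2]|h]] := common_piece s0 st t1 e.
- rewrite !gamma_piece1; [move=> [e1 e2]|apply/andP; lra|apply/andP; lra].
  by left; lra.
- rewrite (@gamma_piece2 s); last by apply/andP; lra.
  rewrite (@gamma_piece2 t); last by apply/andP; lra.
  move=> [e1 e2].
  right; exists (5 * s - 1), (5 * t - 1); split; [lra|lra|lra| |lra].
  by apply/eqP; rewrite eq_complex; apply/andP; split; apply/eqP; lra.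
- rewrite !gamma_piece3; [move=> [e1 e2]|apply/andP; lra|apply/andP; lra].
  by left; lra.
- rewrite (@gamma_piece4 s); last by apply/andP; lra.
  rewrite (@gamma_piece4 t); last by apply/andP; lra.
  move=> [e1 e2].
  right; exists (5 * s - 3), (5 * t - 3); split; [lra|lra|lra| |lra].
  by apply/eqP; rewrite eq_complex; apply/andP; split; apply/eqP; lra.
- rewrite !gamma_piece5; [move=> [e1 e2]|apply/andP; lra|apply/andP; lra].
  by left; lra.
Qed.

(** Blowing up a double point again and again would make the distance of its
    parameters exceed one. *)
Lemma fractal_path_inj s t : 0 <= s <= 1 -> 0 <= t <= 1 ->
  gamma s = gamma t -> s = t.
Proof.
wlog st : s t / s <= t.
  move=> W sI tI e; have [h|h] := leP s t; first exact: W.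
  by apply/esym/W => //; exact: ltW.
move=> /andP[s0 _] /andP[_ t1] e; apply/eqP; apply: contrapT => /negP nst.
have pos : 0 < t - s by rewrite subr_gt0 lt_neqAle nst.
have big n : exists s' t', [/\ 0 <= s', s' <= t', t' <= 1, gamma s' = gamma t' &
    5 ^+ n * (t - s) = t' - s'].
  elim: n => [|n [a [b [a0 ab b1 eab dab]]]].
    by exists s, t; rewrite expr0 mul1r; split.
  have [eq|[a' [b' [? ? ? ? d']]]] := double_point_blowup a0 ab b1 eab.
    by have : 0 < 5 ^+ n * (t - s) by [rewrite mulr_gt0// exprn_gt0]; lra.
  by exists a', b'; split=> //; rewrite exprS -mulrA dab d'.
pose n := Num.truncn (t - s)^-1.
have [a [b [a0 ab b1 _ dab]]] := big n.+1.
have h : (t - s)^-1 < 5 ^+ n.+1.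
  rewrite (lt_le_trans (truncnS_gt _))// -natrX ler_nat ltnW// ltn_expl//.
have : 1 < 5 ^+ n.+1 * (t - s) by rewrite -ltr_pdivrMr// div1r.
by lra.
Qed.

Lemma trace_sub_lo z : open_cell z ->
  trace gamma (center_lo + twist * z) -> trace gamma z.
Proof.
case: z => x y []/=; rewrite !ltr_norml => /andP[x1 x2] /andP[y1 y2] [s /andP[s0 s1]].
have cx u : - (3 / 2) <= complex.Re (gamma u) <= 3 / 2 by have /cell_itv[] := gamma_cell u.
rewrite /center_lo /twist; simpc => e; have := e.
have [hs|hs|hs|[hs|hs]] := five_pieces s.
- have hs' : 0 <= s <= 1 / 5 by apply/andP.
  by rewrite (gamma_piece1 hs') => -[e1 e2]; lra.
- rewrite (gamma_piece2 hs) => -[e1 e2].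
  exists (5 * s - 1); first by move: hs; rewrite /= -!(rwP andP) => *; lra.
  by apply/eqP; rewrite eq_complex/=; apply/andP; split; apply/eqP; lra.
- by rewrite (gamma_piece3 hs) => -[e1 e2]; move: hs; rewrite -!(rwP andP) => *; lra.
- rewrite (gamma_piece4 hs) => -[e1 e2].
  by have := cx (5 * s - 3); rewrite -!(rwP andP) => *; lra.
- have hs' : 4 / 5 <= s <= 1 by apply/andP.
  by rewrite (gamma_piece5 hs') => -[e1 e2]; lra.
Qed.

Lemma trace_sub_hi z : open_cell z ->
  trace gamma (center_hi + twist * z) -> trace gamma z.
Proof.
case: z => x y []/=; rewrite !ltr_norml => /andP[x1 x2] /andP[y1 y2] [s /andP[s0 s1]].
have cx u : - (3 / 2) <= complex.Re (gamma u) <= 3 / 2 by have /cell_itv[] := gamma_cell u.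
rewrite /center_hi /twist; simpc => e; have := e.
have [hs|hs|hs|[hs|hs]] := five_pieces s.
- have hs' : 0 <= s <= 1 / 5 by apply/andP.
  by rewrite (gamma_piece1 hs') => -[e1 e2]; lra.
- rewrite (gamma_piece2 hs) => -[e1 e2].
  by have := cx (5 * s - 1); rewrite -!(rwP andP) => *; lra.
- by rewrite (gamma_piece3 hs) => -[e1 e2]; move: hs; rewrite -!(rwP andP) => *; lra.
- rewrite (gamma_piece4 hs) => -[e1 e2].
  exists (5 * s - 3); first by move: hs; rewrite /= -!(rwP andP) => *; lra.
  by apply/eqP; rewrite eq_complex/=; apply/andP; split; apply/eqP; lra.
- have hs' : 4 / 5 <= s <= 1 by apply/andP.
  by rewrite (gamma_piece5 hs') => -[e1 e2]; lra.
Qed.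

Lemma trace_lo z : trace gamma z -> trace gamma (center_lo + twist * z).
Proof.
move=> [s /andP[s0 s1] <-]; exists ((s + 1) / 5); first by apply/andP; lra.
have -> : s = 5 * ((s + 1) / 5) - 1 by field.
rewrite -refine2 ?gamma_refine//; last by apply/andP; lra.
by congr (refine _ _); field.
Qed.

Lemma trace_hi z : trace gamma z -> trace gamma (center_hi + twist * z).
Proof.
move=> [s /andP[s0 s1] <-]; exists ((s + 3) / 5); first by apply/andP; lra.
have -> : s = 5 * ((s + 3) / 5) - 3 by field.
rewrite -refine4 ?gamma_refine//; last by apply/andP; lra.
by congr (refine _ _); field.
Qed.

End SelfSimilar.

(** * A continuous function holomorphic off the arc *)

Section Potential.
Variable R : realType.
Local Notation C := (R[i]^o).
Implicit Types (x y m : R) (z w o : R[i]) (h g : R[i] -> R[i]).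

(** The Cauchy transform of the uniform probability measure on the disc of radius
    [r], equal to [w^-1] off the disc. *)
Definition disc_kernel (r : R) (w : R[i]) : R[i] :=
  (w^*)%C / (Num.max (cmod w ^+ 2) (r ^+ 2))%:C.

Lemma disc_kernel_out r w : 0 < r -> r <= cmod w -> disc_kernel r w = w^-1.
Proof.
move=> r0 rw; have w0 : w != 0 by rewrite -cmod_gt0; exact: lt_le_trans rw.
rewrite /disc_kernel max_l; last by apply: lerXn2r => //; rewrite nnegrE ?cmod_ge0 ?ltW.
have -> : (cmod w ^+ 2)%:C = w * (w^*)%C.
  by rewrite rmorphXn/= -normC_cmod sqr_normc.
by rewrite invfM mulrCA divff ?mulr1// conjc_eq0.
Qed.

Lemma disc_kernel_le r w : 0 < r -> cmod (disc_kernel r w) <= r^-1.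
Proof.
move=> r0; have mx : 0 < Num.max (cmod w ^+ 2) (r ^+ 2) by rewrite lt_max (exprn_gt0 2 r0) orbT.
rewrite cmodM cmodV cmod_conj cmod_real gtr0_norm// ler_pdivrMr//.
rewrite mulrC ler_pdivlMr//; have [h|h] := leP (cmod w) r.
  rewrite le_max; apply/orP; right; rewrite expr2. apply: ler_wpM2r => //; exact: ltW.
rewrite le_max; apply/orP; left; rewrite expr2; apply: ler_wpM2l ; [exact: cmod_ge0|exact: ltW].
Qed.

Lemma continuous_disc_kernel r : 0 < r -> continuous (disc_kernel r : C -> C).
Proof.
move=> r0 w.
have cid : {for w, continuous (fun w : C => w)} by exact: cvg_id.
apply: (@continuousC_M _ _ w (fun w : C => (w^*)%C)
  (fun w => ((Num.max (cmod w ^+ 2) (r ^+ 2))%:C)^-1)).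
  exact: (continuousC_conj cid).
apply: (@continuousC_V _ _ w (fun w : C => (Num.max (cmod w ^+ 2) (r ^+ 2))%:C)).
  rewrite -cmod_gt0 cmod_real normr_gt0 gt_eqF//.
  by rewrite lt_max (exprn_gt0 2 r0) orbT.
apply: (@continuousC_real _ _ w (fun w : C => Num.max (cmod w ^+ 2) (r ^+ 2))).
apply: (@continuous_max R _ (fun w : C => cmod w ^+ 2) (fun=> r ^+ 2) w).
  have cm := continuousC_cmod cid; exact: (cvgM cm cm).
exact: continuous_fun_cst.
Qed.

Definition pull o z : R[i] := (z - o) / twist.

Lemma pullE z (b : R) :
  pull (0 +i* b) z = (5 / 3 * (complex.Im z - b)) +i* (- (5 / 3 * complex.Re z)).
Proof.
apply: (mulIf (twist_neq0 R)); rewrite /pull divfK ?twist_neq0//.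
by case: z => x y; rewrite /twist; simpc; congr (_ +i* _) => /=; field.
Qed.

Lemma pullK o z : o + twist * pull o z = z.
Proof. by rewrite /pull mulrC divfK ?twist_neq0// addrC subrK. Qed.

Lemma continuous_pull o : continuous (pull o : C -> C).
Proof.
move=> z; apply: (@continuousC_M _ _ z (fun z : C => z - o) (fun=> twist^-1)).
  apply: (@continuousC_B _ _ z (fun z : C => z) (fun=> o)); first exact: cvg_id.
  exact: continuous_fun_cst.
exact: continuous_fun_cst.
Qed.

(** On Cauchy transforms this is the passage from a measure to the average of
    its two copies in the children of the cell. *)
Definition transfer h z : R[i] :=
  (h (pull center_hi z) + h (pull center_lo z)) / (2 * twist).

Lemma transferB h g z :
  transfer h z - transfer g z = transfer (fun w => h w - g w) z.
Proof. by rewrite /transfer -mulrBl; congr (_ / _); ring. Qed.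

Lemma cmod_transfer_le h z (a b : R) : cmod (h (pull center_hi z)) <= a ->
  cmod (h (pull center_lo z)) <= b -> cmod (transfer h z) <= 5 / 6 * (a + b).
Proof.
move=> ha hb; rewrite cmodM cmodV cmodM cmod_twist.
rewrite (_ : (2 : R[i]) = (2%:R)%:C); last by rewrite rmorph_nat.
rewrite cmod_real normr_nat.
have := ler_cmodD (h (pull center_hi z)) (h (pull center_lo z)).
rewrite ler_pdivrMr; last by lra.
by rewrite [X in _ -> _ <= X](_ : _ = a + b); [lra|field].
Qed.

(** The complement of a rectangle whose two pulled back copies are disjoint, by
    the width 10/3, and lie inside it, by the height 11/2. *)
Definition far : set R[i] :=
  [set z | 5 / 3 <= `|complex.Re z| \/ 11 / 4 <= `|complex.Im z|].

Lemma farE z : far z <->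
  ((complex.Re z <= - (5 / 3) \/ 5 / 3 <= complex.Re z) \/
   (complex.Im z <= - (11 / 4) \/ 11 / 4 <= complex.Im z)).
Proof.
have N (a b : R) : a <= `|b| <-> (b <= - a \/ a <= b).
  by rewrite ler_normr lerNr; split=> [/orP[]|[]]; [right|left|move=> ->; rewrite orbT|move=> ->].
by rewrite /far/=; split=> -[/N h|/N h]; [left|right|left|right].
Qed.

Lemma far_pull_hi z : far z -> far (pull center_hi z).
Proof.
move=> /farE h; apply/farE; rewrite pullE/=; case: h => [[h|h]|[h|h]].
- by right; right; lra.
- by right; left; lra.
- by left; left; lra.
- by left; right; lra.
Qed.

Lemma far_pull_lo z : far z -> far (pull center_lo z).
Proof.
move=> /farE h; apply/farE; rewrite pullE/=; case: h => [[h|h]|[h|h]].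
- by right; right; lra.
- by right; left; lra.
- by left; left; lra.
- by left; right; lra.
Qed.

Lemma far_one_pull z : far (pull center_hi z) \/ far (pull center_lo z).
Proof.
rewrite !farE !pullE/=; have [h|h] := leP (complex.Im z) 0.
  by left; left; left; lra.
by right; left; right; lra.
Qed.

Lemma far_cmod_ge z : far z -> 5 / 3 <= cmod z.
Proof.
move=> [h|h]; first by rewrite (le_trans h)// normr_Re_le.
by rewrite (@le_trans _ _ (11 / 4))//; [lra|rewrite (le_trans h)// normr_Im_le].
Qed.

(** The weight [|z|^-2] far from the cell is what a charge of total mass zero
    produces; keeping track of it next to the supremum norm makes [transfer] a
    contraction, since at every point one of the two children is far. *)
Definition small_potential h m :=
  (forall z, cmod (h z) <= 8 * m) /\
  (forall z, far z -> cmod z ^+ 2 * cmod (h z) <= m).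

(** This is where the rate 19/20 comes from: 3/10 is half the scale, and the two
    sums are the squared distances to the centres of the children. *)
Lemma far_ineq x y : (x <= - (5 / 3) \/ 5 / 3 <= x) \/ (y <= - (11 / 4) \/ 11 / 4 <= y) ->
  3 / 10 * (x ^+ 2 + y ^+ 2) * ((x ^+ 2 + (y - 1) ^+ 2) + (x ^+ 2 + (y + 1) ^+ 2)) <=
  19 / 20 * ((x ^+ 2 + (y - 1) ^+ 2) * (x ^+ 2 + (y + 1) ^+ 2)).
Proof.
move=> h.
have [X hX] : exists X, X = x ^+ 2 + y ^+ 2 by exists (x ^+ 2 + y ^+ 2).
have -> : (x ^+ 2 + (y - 1) ^+ 2) + (x ^+ 2 + (y + 1) ^+ 2) = 2 * X + 2 by rewrite hX; ring.
have -> : (x ^+ 2 + (y - 1) ^+ 2) * (x ^+ 2 + (y + 1) ^+ 2) = (X - 1) ^+ 2 + 4 * x ^+ 2.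
  by rewrite hX; ring.
rewrite -hX.
have x0 := sqr_ge0 x; have y0 := sqr_ge0 y.
have : 25 / 9 <= x ^+ 2 \/ 121 / 16 <= X.
  by case: h => [[h|h]|[h|h]]; [left|left|right|right]; rewrite ?hX; nra.
by case=> hh; nra.
Qed.

Lemma transfer_contract h m : 0 <= m -> small_potential h m ->
  small_potential (transfer h) (19 / 20 * m).
Proof.
move=> m0 [h8 hfar].
have fm z : far z -> cmod (h z) <= m.
  move=> fz; have := hfar z fz; have := far_cmod_ge fz => z1.
  have z2 : 1 <= cmod z ^+ 2 by rewrite expr_ge1//; lra.
  by apply: le_trans; rewrite ler_peMl ?cmod_ge0.
split=> z.
  have [fz|fz] := far_one_pull z.
    by have := cmod_transfer_le (fm _ fz) (h8 (pull center_lo z)); lra.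
  by have := cmod_transfer_le (h8 (pull center_hi z)) (fm _ fz); lra.
move=> fz; have h1 := hfar _ (far_pull_hi fz); have h2 := hfar _ (far_pull_lo fz).
have h3 := cmod_transfer_le (lexx _) (lexx (cmod (h (pull center_lo z)))).
have sq (t : R) : 5 / 3 <= t -> 25 / 9 <= t ^+ 2 by move=> ?; nra.
have g1 := sq _ (far_cmod_ge (far_pull_hi fz)).
have g2 := sq _ (far_cmod_ge (far_pull_lo fz)).
move: h1 h2 h3 g1 g2; rewrite !cmod_sqr !pullE/=.
set a := cmod (h _); set b := cmod (h _); move=> h1 h2 h3 g1 g2.
have /far_ineq := (farE z).1 fz.
set x := complex.Re z in h1 h2 g1 g2 *; set y := complex.Im z in h1 h2 g1 g2 *.
set D1 := x ^+ 2 + (y - 1) ^+ 2; set D2 := x ^+ 2 + (y + 1) ^+ 2.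
set X := x ^+ 2 + y ^+ 2 => ineq.
have D1E : (5 / 3 * (y - 1)) ^+ 2 + (- (5 / 3 * x)) ^+ 2 = 25 / 9 * D1 by rewrite /D1; field.
have D2E : (5 / 3 * (y - -1)) ^+ 2 + (- (5 / 3 * x)) ^+ 2 = 25 / 9 * D2 by rewrite /D2; field.
rewrite D1E in h1 g1; rewrite D2E in h2 g2.
have D10 : 0 < D1 by lra.
have D20 : 0 < D2 by lra.
have X0 : 0 <= X by rewrite addr_ge0 ?sqr_ge0.
have a1 : a <= 9 / 25 * m / D1 by rewrite ler_pdivlMr//; lra.
have b1 : b <= 9 / 25 * m / D2 by rewrite ler_pdivlMr//; lra.
apply: (@le_trans _ _ (X * (5 / 6 * (9 / 25 * m / D1 + 9 / 25 * m / D2)))).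
  apply: ler_wpM2l => //; apply: (le_trans h3).
  by apply: ler_wpM2l; [lra|exact: lerD].
have -> : X * (5 / 6 * (9 / 25 * m / D1 + 9 / 25 * m / D2)) =
          m * (3 / 10 * X * (D1 + D2)) / (D1 * D2).
  by field; rewrite !gt_eqF.
rewrite ler_pdivrMr ?mulr_gt0//.
have -> : 19 / 20 * m * (D1 * D2) = m * (19 / 20 * (D1 * D2)) by ring.
exact: ler_wpM2l.
Qed.

(** A point of the cell on the left of the first segment of the path; the images
    of a small disc about it in the cells of all generations avoid the arc. *)
Definition hub : R[i] := (- (29 / 20)) +i* 0.

Fixpoint potential (n : nat) : R[i] -> R[i] :=
  if n is k.+1 then transfer (potential k)
  else fun z => disc_kernel (1 / 40) (z - hub).

Lemma continuous_potential n : continuous (potential n : C -> C).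
Proof.
elim: n => [|n IH] z /=.
  have h : {for z, continuous (fun z : C => z - hub : C)}.
    apply: (@continuousC_B _ _ z (fun z : C => z) (fun=> hub)); first exact: cvg_id.
    exact: continuous_fun_cst.
  by apply: (continuous_compose h); apply: continuous_disc_kernel; lra.
apply: (@continuousC_M _ _ z (fun z => potential n (pull center_hi z) +
  potential n (pull center_lo z)) (fun=> (2 * twist)^-1)); last exact: continuous_fun_cst.
exact: (continuousC_D (continuous_compose (@continuous_pull center_hi z) (IH _))
  (continuous_compose (@continuous_pull center_lo z) (IH _))).
Qed.

End Potential.
Arguments hub {R}.
Arguments far {R}.
Arguments potential {R}.

Section PotentialLimit.
Variable R : realType.
Local Notation C := (R[i]^o).
Implicit Types (x y m : R) (z w o : R[i]) (h g : R[i] -> R[i]).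

Lemma far_hub z : far z -> 1 / 5 <= cmod (z - hub).
Proof.
move=> /farE h; have := normr_Re_le (z - hub); have := normr_Im_le (z - hub).
rewrite !raddfB/= !ler_norml => /andP[? ?] /andP[? ?].
by case: h => [[h|h]|[h|h]]; lra.
Qed.

Lemma potential0_far z : far z -> potential 0 z = (z - hub)^-1.
Proof. by move=> /far_hub h; rewrite /= disc_kernel_out//; lra. Qed.

Lemma transfer_kernel z o : far (pull o z) ->
  potential 0 (pull o z) / twist = (z - o - twist * hub)^-1.
Proof.
move=> /potential0_far ->; rewrite -invfM; congr (_^-1).
by rewrite mulrBl [pull o z * _]mulrC /pull mulrC divfK ?twist_neq0// [hub * _]mulrC.
Qed.

Lemma cmod_ratio_le z o (b k : R) : 0 < b -> cmod o <= k * b -> b <= cmod (z - o) ->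
  cmod z <= (1 + k) * cmod (z - o).
Proof.
move=> b0 ho hz; have := ler_cmodD (z - o) o; rewrite subrK.
have k0 : 0 <= k by rewrite -(pmulr_lge0 _ b0); exact: le_trans (cmod_ge0 o) ho.
have : k * b <= k * cmod (z - o) by exact: ler_wpM2l.
by lra.
Qed.

(** Moving a unit charge changes its potential by a dipole field. The points [o]
    in question are the images of [hub] in the two children. *)
Lemma pole_shift_le z o : far z ->
  (2 * complex.Re o = 0) -> - 187 / 100 <= complex.Im o <= 187 / 100 ->
  cmod z ^+ 2 * cmod ((z - o)^-1 - (z - hub)^-1) <= 180.
Proof.
move=> fz Reo /andP[lo up].
have hz := far_hub fz.
have ho : 44 / 50 <= cmod (z - o).
  have /farE h := fz; have := normr_Re_le (z - o); have := normr_Im_le (z - o).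
  rewrite !raddfB/= !ler_norml => /andP[? ?] /andP[? ?].
  by case: h => [[h|h]|[h|h]]; lra.
have on : cmod o <= 187 / 100.
  have := cmod_le_ReIm o; have -> : complex.Re o = 0 by lra.
  rewrite normr0 add0r; have : `|complex.Im o| <= 187 / 100 by rewrite ler_norml; apply/andP; lra.
  by lra.
have hn : cmod (hub : R[i]) <= 29 / 20.
  have := cmod_le_ReIm (hub : R[i]); rewrite /hub /= normr0 addr0 normrN ger0_norm//; lra.
have zo : cmod z <= 4 * cmod (z - o).
  have -> : (4 : R) = 1 + 3 by ring.
  by apply: cmod_ratio_le ho; lra.
have zh : cmod z <= 9 * cmod (z - hub).
  have -> : (9 : R) = 1 + 8 by ring.
  by apply: cmod_ratio_le hz; lra.
have a0 : 0 < cmod (z - o) by lra.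
have b0 : 0 < cmod (z - hub) by lra.
have -> : (z - o)^-1 - (z - hub)^-1 = (o - hub) / ((z - o) * (z - hub)).
  by field; rewrite -[z - o != 0]cmod_gt0 -[z - hub != 0]cmod_gt0 a0 b0.
rewrite cmodM cmodV cmodM mulrA ler_pdivrMr ?mulr_gt0//.
have oh : cmod (o - hub) <= 5 by have := ler_cmodD o (- hub); rewrite cmodN; lra.
apply: (@le_trans _ _ ((4 * cmod (z - o)) * (9 * cmod (z - hub)) * 5)).
  rewrite expr2; apply: ler_pM => //; rewrite ?mulr_ge0 ?cmod_ge0//.
  by apply: ler_pM; rewrite ?cmod_ge0.
by have : 0 < cmod (z - o) * cmod (z - hub) by [rewrite mulr_gt0]; lra.
Qed.

Lemma small_potential_base :
  small_potential (fun z : R[i] => potential 1 z - potential 0 z) 180.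
Proof.
have b40 z : cmod (potential 0 z) <= 40.
  have r0 : 0 < 1 / 40 :> R by lra.
  have e40 : (1 / 40)^-1 = 40 :> R by field.
  by have := disc_kernel_le (z - hub) r0; rewrite e40.
split=> z.
  have := cmod_transfer_le (b40 (pull center_hi z)) (b40 (pull center_lo z)).
  have := ler_cmodD (potential 1 z) (- potential 0 z); rewrite cmodN.
  by have := b40 z; rewrite [potential 1 z]/=; lra.
move=> fz; rewrite [potential 1]/= /transfer.
have -> : (potential 0 (pull center_hi z) + potential 0 (pull center_lo z)) / (2 * twist) =
  ((z - center_hi - twist * hub)^-1 + (z - center_lo - twist * hub)^-1) / 2.
  rewrite -transfer_kernel; last exact: far_pull_hi.
  rewrite -transfer_kernel; last exact: far_pull_lo.
  by field; rewrite twist_neq0.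
rewrite potential0_far//.
set a := (z - center_hi - _)^-1; set b := (z - center_lo - _)^-1; set c := (z - hub)^-1.
have -> : (a + b) / 2 - c = ((a - c) + (b - c)) / 2 by field.
have ha : cmod z ^+ 2 * cmod (a - c) <= 180.
  rewrite /a -addrA -opprD; apply: pole_shift_le => //.
    by rewrite /center_hi /twist /hub /=; ring.
  by rewrite /center_hi /twist /hub /=; apply/andP; lra.
have hb : cmod z ^+ 2 * cmod (b - c) <= 180.
  rewrite /b -addrA -opprD; apply: pole_shift_le => //.
    by rewrite /center_lo /twist /hub /=; ring.
  by rewrite /center_lo /twist /hub /=; apply/andP; lra.
rewrite cmodM cmodV (_ : cmod (2 : R[i]) = 2); last first.
  rewrite (_ : (2 : R[i]) = (2%:R)%:C); last by rewrite rmorph_nat.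
  by rewrite cmod_real normr_nat.
rewrite mulrA ler_pdivrMr//.
have : cmod z ^+ 2 * cmod (a - c + (b - c)) <= cmod z ^+ 2 * (cmod (a - c) + cmod (b - c)).
  by apply: ler_wpM2l; [rewrite sqr_ge0|exact: ler_cmodD].
by lra.
Qed.

Lemma potential_step n : small_potential
  (fun z : R[i] => potential n.+1 z - potential n z) ((19 / 20) ^+ n * 180).
Proof.
elim: n => [|n IH]; first by rewrite expr0 mul1r; exact: small_potential_base.
have k0 : 0 <= (19 / 20) ^+ n * 180 :> R by rewrite mulr_ge0// exprn_ge0//; lra.
have tE : transfer (fun z : R[i] => potential n.+1 z - potential n z) =
    (fun z => potential n.+2 z - potential n.+1 z).
  by apply/funext => z; rewrite -transferB.
by have := transfer_contract k0 IH; rewrite tE exprS !mulrA.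
Qed.

Lemma potential_far n z : far z ->
  cmod z ^+ 2 * cmod (potential n z - (z - hub)^-1) <= 3600.
Proof.
move=> fz.
have k0 j : 0 <= (19 / 20) ^+ j :> R by rewrite exprn_ge0//; lra.
suff : cmod z ^+ 2 * cmod (potential n z - potential 0 z) <= 3600 * (1 - (19 / 20) ^+ n).
  by rewrite potential0_far//; have := k0 n; lra.
elim: n => [|n IH]; first by rewrite subrr cmod0 mulr0 expr0 subrr mulr0.
have [_ /(_ z fz) st] := potential_step n.
have -> : potential n.+1 z - potential 0 z =
  (potential n.+1 z - potential n z) + (potential n z - potential 0 z) by ring.
have : cmod z ^+ 2 * cmod ((potential n.+1 z - potential n z) + (potential n z - potential 0 z))
   <= cmod z ^+ 2 * (cmod (potential n.+1 z - potential n z) + cmod (potential n z - potential 0 z)).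
  by apply: ler_wpM2l; [rewrite sqr_ge0|exact: ler_cmodD].
by rewrite [(19 / 20) ^+ n.+1]exprS; have := k0 n; lra.
Qed.

(** The charges have total mass one. *)
Lemma potential_at_infinity n z : far z ->
  cmod (z * potential n z - 1) <= 4000 / cmod z.
Proof.
move=> fz; have z1 := far_cmod_ge fz; have hz := far_hub fz.
have h1 := potential_far n fz.
have hn : cmod (hub : R[i]) <= 29 / 20.
  have := cmod_le_ReIm (hub : R[i]); rewrite /hub /= normr0 addr0 normrN ger0_norm//; lra.
have zh : cmod z <= 9 * cmod (z - hub).
  have -> : (9 : R) = 1 + 8 by ring.
  by apply: cmod_ratio_le hz; lra.
have b0 : 0 < cmod (z - hub) by lra.
rewrite ler_pdivlMr; last by lra.
have -> : z * potential n z - 1 = z * (potential n z - (z - hub)^-1) + hub / (z - hub).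
  by field; rewrite -cmod_gt0.
have := ler_cmodD (z * (potential n z - (z - hub)^-1)) (hub / (z - hub)).
rewrite !cmodM cmodV -(ler_pM2r (_ : 0 < cmod z)); last by lra.
set p := cmod (potential n z - _); set q := cmod (z - hub).
have : cmod (hub : R[i]) / q * cmod z <= 14.
  rewrite mulrAC ler_pdivrMr//.
  apply: (@le_trans _ _ (29 / 20 * (9 * q))); first by apply: ler_pM => //; rewrite cmod_ge0.
  by rewrite /q; lra.
rewrite mulrDl; have -> : cmod z * p * cmod z = cmod z ^+ 2 * p by ring.
by rewrite /p; lra.
Qed.

(** The [2 ^ n] discs charged by [potential n]. *)
Fixpoint holes (n : nat) : set R[i] :=
  if n is k.+1 then [set z | holes k (pull center_hi z) \/ holes k (pull center_lo z)]
  else [set z | cmod (z - hub) < 1 / 40].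

Definition rational_off (K : set R[i]) h := exists Q S : {poly R[i]},
  forall z, ~ K z -> S.[z] != 0 /\ h z = Q.[z] / S.[z].

Lemma rational_off_poly K (p : {poly R[i]}) : rational_off K (fun z => p.[z]).
Proof. by exists p, 1 => z _; rewrite hornerC oner_neq0 divr1. Qed.

Lemma rational_offD K h g : rational_off K h -> rational_off K g ->
  rational_off K (fun z => h z + g z).
Proof.
move=> [Q1 [S1 H1]] [Q2 [S2 H2]]; exists (Q1 * S2 + Q2 * S1), (S1 * S2) => z Kz.
have [s1 ->] := H1 z Kz; have [s2 ->] := H2 z Kz.
by rewrite !hornerE mulf_neq0//; split=> //; field; rewrite ?s1 ?s2.
Qed.

Lemma rational_offM K h g : rational_off K h -> rational_off K g ->
  rational_off K (fun z => h z * g z).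
Proof.
move=> [Q1 [S1 H1]] [Q2 [S2 H2]]; exists (Q1 * Q2), (S1 * S2) => z Kz.
have [s1 ->] := H1 z Kz; have [s2 ->] := H2 z Kz.
by rewrite !hornerM mulf_neq0//; split=> //; field; rewrite ?s1 ?s2.
Qed.

Lemma rational_off_pull K h o : rational_off K h ->
  rational_off (fun z => K (pull o z)) (fun z => h (pull o z)).
Proof.
move=> [Q [S H]]; pose L : {poly R[i]} := twist^-1 *: ('X - o%:P).
have LE z : L.[z] = pull o z by rewrite /L !hornerE /pull mulrC.
exists (Q \Po L), (S \Po L) => z Kz.
by rewrite !horner_comp LE; exact: H.
Qed.

Lemma rational_off_sub K K' h : (K `<=` K') -> rational_off K h -> rational_off K' h.
Proof. by move=> KK' [Q [S H]]; exists Q, S => z Kz; apply: H => /KK'. Qed.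

Lemma eq_rational_off K g h : (forall z, g z = h z) ->
  rational_off K g -> rational_off K h.
Proof. by move=> gh [Q [S H]]; exists Q, S => z Kz; rewrite -gh; exact: H. Qed.

Lemma rational_off_cst K (c : R[i]) : rational_off K (fun=> c).
Proof. by apply: eq_rational_off (rational_off_poly K c%:P) => z; rewrite hornerC. Qed.

Lemma potential_rational n : rational_off (holes n) (potential n).
Proof.
elim: n => [|n IH].
  exists 1, ('X - hub%:P) => z /= /negP; rewrite -leNgt => hz.
  have r0 : 0 < 1 / 40 :> R by lra.
  rewrite hornerXsubC hornerC (disc_kernel_out r0 hz).
  have zh : 0 < cmod (z - hub) by lra.
  rewrite cmod_gt0 in zh; by split; [exact: zh|rewrite mul1r].
apply: (@rational_offM _ (fun z => _) (fun=> (2 * twist)^-1)); last exact: rational_off_cst.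
by apply: rational_offD; apply: rational_off_sub (rational_off_pull _ IH) => z /=; [left|right].
Qed.

Lemma holes_cell n z : holes n z -> open_cell z.
Proof.
elim: n z => [|n IH] z /=.
  move=> h; have := le_lt_trans (normr_Re_le _) h; have := le_lt_trans (normr_Im_le _) h.
  rewrite !raddfB/= !ltr_norml => /andP[? ?] /andP[? ?].
  by split; rewrite ltr_norml; apply/andP; lra.
by case=> /IH []; rewrite !pullE/= !ltr_norml => /andP[? ?] /andP[? ?];
  split; rewrite ltr_norml; apply/andP; lra.
Qed.

End PotentialLimit.
Arguments holes {R}.

Section ArcPotential.
Variable R : realType.
Local Notation C := (R[i]^o).
Implicit Types (s t : R) (z w : R[i]).

Section holes.
Variable gamma : R -> R[i].
Hypothesis gamma_ports : joins_ports gamma.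
Hypothesis gamma_cell : forall s, cell (gamma s).
Hypothesis gamma_refine : forall s, gamma s = refine gamma s.

(** A hole lies in the open cell of its generation, where the arc only has its own
    copy, and the copy avoids the disc about [hub]. *)
Lemma holes_off_trace n z : holes n z -> ~ trace gamma z.
Proof.
elim: n z => [|n IH] z /=.
  move=> h; have := le_lt_trans (normr_Re_le _) h; have := le_lt_trans (normr_Im_le _) h.
  rewrite !raddfB/= !ltr_norml => /andP[y1 y2] /andP[x1 x2] [s /andP[s0 s1] sz].
  have cy u : - 2 <= complex.Im (gamma u) <= 2 by have /cell_itv[] := gamma_cell u.
  move: x1 x2 y1 y2; rewrite -sz.
  have [hs|hs|hs|[hs|hs]] := five_pieces s.
  - have hs' : 0 <= s <= 1 / 5 by apply/andP.
    by rewrite (gamma_piece1 gamma_ports gamma_refine hs') /=; lra.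
  - rewrite (gamma_piece2 gamma_ports gamma_refine hs) /=.
    by have := cy (5 * s - 1); rewrite -!(rwP andP) => *; lra.
  - rewrite (gamma_piece3 gamma_ports gamma_refine hs) /=.
    by move: hs; rewrite -!(rwP andP) => *; lra.
  - rewrite (gamma_piece4 gamma_ports gamma_refine hs) /=.
    by have := cy (5 * s - 3); rewrite -!(rwP andP) => *; lra.
  - have hs' : 4 / 5 <= s <= 1 by apply/andP.
    by rewrite (gamma_piece5 gamma_ports gamma_refine hs') /=; lra.
move=> [h|h]; rewrite -[z in trace _ z](pullK center_hi).
  move=> /(trace_sub_hi gamma_ports gamma_cell gamma_refine (holes_cell h)).
  exact: IH h.
rewrite pullK -[z in trace _ z](pullK center_lo).
move=> /(trace_sub_lo gamma_ports gamma_cell gamma_refine (holes_cell h)).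
exact: IH h.
Qed.

Lemma holes_near_trace n z : holes n z ->
  exists2 w, trace gamma w & cmod (z - w) <= 7 * (3 / 5) ^+ n.
Proof.
elim: n z => [|n IH] z.
  move=> /holes_cell[zx zy]; exists (gamma 0); first by exists 0 => //=; rewrite lexx ler01.
  rewrite expr0 mulr1; apply: cell_diam; last exact: gamma_cell.
  by split; exact: ltW.
have key o w : cmod (pull o z - w) <= 7 * (3 / 5) ^+ n ->
    cmod (z - (o + twist * w)) <= 7 * (3 / 5) ^+ n.+1.
  have -> : z - (o + twist * w) = twist * (pull o z - w).
    by rewrite -{1}(pullK o z); ring.
  by rewrite cmodM cmod_twist exprS; lra.
move=> [/IH[w Ew h]|/IH[w Ew h]].
  by exists (center_hi + twist * w); [exact: trace_hi|exact: key].
by exists (center_lo + twist * w); [exact: trace_lo|exact: key].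
Qed.

End holes.

(** What the rest of the proof uses: a potential [f] of the limit measure and its
    approximants [fn], rational off sets [K n] that avoid the arc and shrink to
    it. *)
Theorem arc_with_potential : exists (gamma : R -> R[i]) (f : R[i] -> R[i])
    (fn : nat -> R[i] -> R[i]) (K : nat -> set R[i]),
  [/\ continuous (gamma : R -> C),
      forall s t, 0 <= s <= 1 -> 0 <= t <= 1 -> gamma s = gamma t -> s = t &
      forall z, trace gamma z -> cmod z <= 4] /\
  [/\ forall n, continuous (fn n : C -> C), continuous (f : C -> C),
      forall e : R, 0 < e -> exists N, forall n, (N <= n)%N ->
        forall z, cmod (fn n z - f z) < e,
      exists2 M : R, 0 < M & forall z, cmod (f z) <= M &
      forall z, 5 <= cmod z -> cmod (z * f z - 1) <= 4000 / cmod z] /\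
  [/\ forall n, rational_off (K n) (fn n),
      forall n z, K n z -> ~ trace gamma z &
      forall e : R, 0 < e -> exists N, forall n, (N <= n)%N ->
        forall z, K n z -> exists2 w, trace gamma w & cmod (z - w) < e].
Proof.
have [gamma [cg gp gc gr]] := fractal_path_exists R.
have k1 : (0 : R) <= 19 / 20 < (1 : R) by apply/andP; split; lra.
have k2 : (0 : R) <= 3 / 5 < (1 : R) by apply/andP; split; lra.
have step n (z : R[i]) : cmod (potential n.+1 z - potential n z) <= 1440 * (19 / 20) ^+ n.
  by have [/(_ z)] := potential_step R n; lra.
have [f hf] := choice (fun z => geometric_limit k1 (ler0n _ 1440) (step^~ z)).
have [M M0 {}hf] : exists2 M : R, 0 <= M &
    forall z n, cmod (potential n z - f z) <= M * (19 / 20) ^+ n.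
  exists (2 * (1440 / (1 - 19 / 20))); last exact: hf.
  apply: mulr_ge0; first exact: ler0n.
  by apply: divr_ge0; [exact: ler0n|lra].
have unif (e : R) : 0 < e -> exists N, forall n, (N <= n)%N ->
    forall z, cmod (potential n z - f z) < e.
  move=> e0; have [N hN] := geometric_small M k1 e0.
  by exists N => n Nn z; apply: le_lt_trans (hf z n) (hN n Nn).
exists gamma, f, potential, holes; split; [split=> //|split; split=> //].
- exact: (fractal_path_inj gp gc gr).
- move=> _ [s _ <-]; have /cell_itv[/andP[? ?] /andP[? ?]] := gc s.
  have h1 : `|complex.Re (gamma s)| <= 3 / 2 by rewrite ler_norml; apply/andP; lra.
  have h2 : `|complex.Im (gamma s)| <= 2 by rewrite ler_norml; apply/andP; lra.
  by have := cmod_le_ReIm (gamma s); lra.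
- exact: continuous_potential.
- exact: (@continuous_geometric_limit R C potential f _ M k1
    (@continuous_potential R) (fun n z => hf z n)).
- have r0 : 0 < 1 / 40 :> R by lra.
  exists (M + (1 / 40)^-1).
    by apply: ltr_wpDl => //; rewrite invr_gt0.
  move=> z; rewrite -[f z](subrK (potential 0 z)).
  apply: le_trans (ler_cmodD _ _) _; apply: lerD; last exact: disc_kernel_le.
  by have := hf z 0%N; rewrite expr0 mulr1 cmod_distC.
- move=> z z5.
  have fz : far z.
    have := cmod_le_ReIm z; have [h|h] := leP (5 / 3) `|complex.Re z|; first by left.
    by have [h'|h'] := leP (11 / 4) `|complex.Im z|; [right|lra].
  apply/ler_addgt0Pr => e e0.
  have z0 : 0 < cmod z by lra.
  have ez : 0 < e / cmod z by rewrite divr_gt0.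
  have [N /(_ N (leqnn N) z) hN] := unif _ ez.
  have h1 := potential_at_infinity N fz.
  have -> : z * f z - 1 = (z * potential N z - 1) + - (z * (potential N z - f z)) by ring.
  have := ler_cmodD (z * potential N z - 1) (- (z * (potential N z - f z))).
  rewrite cmodN cmodM; have : cmod z * cmod (potential N z - f z) < e.
    by rewrite mulrC -ltr_pdivlMr.
  by lra.
- exact: potential_rational.
- by move=> n z; exact: holes_off_trace.
- move=> e e0; have [N hN] := geometric_small 7 k2 e0.
  exists N => n Nn z /(holes_near_trace gp gc gr)[w Ew hw].
  by exists w => //; apply: le_lt_trans hw (hN n Nn).
Qed.

End ArcPotential.

(** * Zeros of limits of functions rational off shrinking sets *)

Section ZeroFree.
Variable R : realType.
Local Notation C := (R[i]^o).
Implicit Types (s t : R) (z w : R[i]).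

Lemma cis_2pi_nat n : cis (n%:R * (2 * pi) : R) = 1.
Proof.
rewrite (mulr_natl (2 * pi) n) cisMn /cis mulr_natl cos2pi sin2pi.
exact: expr1n.
Qed.

Lemma circle_surj (rad : R) z : cmod z = rad ->
  exists2 s, 0 <= s <= 1 & z = circle rad s.
Proof.
move=> zr; have [z0|z0] := eqVneq z 0.
  exists 0; first by rewrite lexx ler01.
  by rewrite -zr z0 cmod0 /circle mul0r.
have [x hx] := polar_form z0.
have p0 : 0 < 2 * pi :> R by rewrite mulr_gt0// pi_gt0.
pose t := x / (2 * pi); pose m := Num.floor t.
have /andP[m1 m2] : m%:~R <= t < (m + 1)%:~R by exact: floor_itv.
exists (t - m%:~R).
  by rewrite subr_ge0 m1 lerBlDr addrC -(intrD _ m 1) ltW.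
rewrite /circle hx zr; congr (_ * _).
rewrite mulrBl cisD /t divfK ?gt_eqF// cisN.
suff -> : cis (m%:~R * (2 * pi)) = 1 :> R[i] by rewrite invr1 mulr1.
case: (m) => n; first by rewrite -pmulrn cis_2pi_nat.
by rewrite NegzE mulrNz mulNr cisN -pmulrn cis_2pi_nat invr1.
Qed.

(** One number bounds both the width of the neighbourhood and the modulus, which
    makes a single compactness argument enough. *)
Lemma nonvanishing_near_trace (gamma : R -> R[i]) (u : R[i] -> R[i]) :
  continuous (gamma : R -> C) -> continuous (u : C -> C) ->
  (forall z, trace gamma z -> u z != 0) ->
  exists2 e : R, 0 < e & forall w z, trace gamma w -> cmod (z - w) < e -> e < cmod (u z).
Proof.
move=> cg cu u0.
pose P (e : R) s := forall z, cmod (z - gamma s) < e -> e < cmod (u z).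
move/compact_near_coveringP : (@segment_compact R 0 1) => /(_ R 0^'+ P _) near.
have : \forall e \near 0^'+, `[0, 1]%classic `<=` P e.
  apply: near => s0; rewrite /= in_itv/= => s0I.
  have a0 : 0 < cmod (u (gamma s0)) by rewrite cmod_gt0 u0//; exists s0.
  set a := cmod _ in a0; have a2 : 0 < a / 2 by rewrite divr_gt0.
  have /continuous_cmodP/(_ _ a2)/nbhs_cmodP[d d0 hd] := cu (gamma s0).
  have d2 : 0 < d / 2 by rewrite divr_gt0.
  have /continuous_cmodP/(_ _ d2) hs := cg s0.
  exists ([set s | cmod (gamma s - gamma s0) < d / 2],
          [set e | e < d / 2 /\ e < a / 2]) => /=.
    split; first exact: hs.
    by near=> e; split; near: e; exact: nbhs_right_lt.
  move=> [s e] /= [h1 [h2 h3]] z hz.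
  have := hd z; have := ler_cmodD (z - gamma s) (gamma s - gamma s0).
  rewrite addrA subrK => h4 /(_ _)h5.
  have {}h5 : cmod (u z - u (gamma s0)) < a / 2 by apply: h5; lra.
  have := ler_cmodD (u z) (- (u z - u (gamma s0))); rewrite cmodN.
  by rewrite opprB addrC subrK -/a; lra.
move=> hP; have hP2 : \forall e \near 0^'+, `[0, 1]%classic `<=` P e /\ 0 < e.
  by near=> e; split; near: e => //; exact: nbhs_right_gt.
have [e [eP e0]] := @filter_ex _ _ (at_right_proper_filter 0) _ hP2.
exists e => // _ z [s sI <-]; apply: eP.
by rewrite /= in_itv.
Unshelve. all: by end_near. Qed.

(** A Hurwitz theorem. An approximant [un] agrees with a rational function off a
    small neighbourhood of the arc, where it has no zeros; dividing by its
    finitely many zeros in the disc leaves a zero-free continuous function, to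
    which [disc_no_root] applies. *)
Theorem zero_free_limit (gamma : R -> R[i]) (u : R[i] -> R[i])
    (un : nat -> R[i] -> R[i]) (K : nat -> set R[i]) (rad : R) :
  continuous (gamma : R -> C) -> 5 <= rad ->
  (forall z, trace gamma z -> cmod z <= 4) ->
  continuous (u : C -> C) -> (forall n, continuous (un n : C -> C)) ->
  (forall e : R, 0 < e -> exists N, forall n, (N <= n)%N ->
    forall z, cmod z <= rad -> cmod (un n z - u z) < e) ->
  (forall n, rational_off (K n) (un n)) ->
  (forall e : R, 0 < e -> exists N, forall n, (N <= n)%N ->
    forall z, K n z -> exists2 w, trace gamma w & cmod (z - w) < e) ->
  (forall z, trace gamma z -> u z != 0) ->
  (forall z, cmod z = rad -> u z != 0) ->
  has_periodic_arg (fun s => u (circle rad s)) ->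
  forall z, cmod z <= rad -> u z != 0.
Proof.
move=> cg rad5 E4 cu cun unif rat near uE ucirc parg z1 z1rad.
have rad0 : 0 < rad by lra.
apply/negP => /eqP uz1.
have [e0 e00 he0] := nonvanishing_near_trace cg cu uE.
have [c c0 hc] : exists2 c, 0 < c & forall z, cmod z = rad -> c <= cmod (u z).
  have [||c c0 hc] := @positive_lower_bound R (fun s => cmod (u (circle rad s))).
  - move=> s; apply: continuousC_cmod.
    exact: (continuous_compose (@continuous_circle R rad s) (cu _)).
  - by move=> s _; rewrite cmod_gt0 ucirc// cmod_circle// ltW.
  by exists c => // z /circle_surj[s sI ->]; exact: hc.
pose e := Num.min e0 1.
have e0' : 0 < e by rewrite lt_min e00 ltr01.
have ee0 : e <= e0 by rewrite ge_min lexx.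
have e1 : e <= 1 by rewrite ge_min lexx orbT.
have he w z : trace gamma w -> cmod (z - w) < e -> e < cmod (u z).
  by move=> Ew h; apply: le_lt_trans ee0 (he0 w z Ew (lt_le_trans h ee0)).
pose tol := Num.min e c / 4.
have tol0 : 0 < tol by rewrite divr_gt0// lt_min e0' c0.
have tole : tol <= e / 4 by rewrite ler_pM2r ?invr_gt0// ge_min lexx.
have tolc : tol <= c / 4 by rewrite ler_pM2r ?invr_gt0// ge_min lexx orbT.
have e2 : 0 < e / 2 by rewrite divr_gt0.
have [N1 hN1] := unif _ tol0; have [N2 hN2] := near _ e2.
pose n := maxn N1 N2.
have {}hN1 := hN1 n (leq_maxl _ _); have {}hN2 := hN2 n (leq_maxr _ _).
(* recentred so as to vanish at [z1] exactly *)
pose h z := un n z - un n z1.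
have ch : continuous (h : C -> C).
  move=> z; apply: (@continuousC_B _ _ z (un n) (fun=> un n z1)); first exact: cun.
  exact: continuous_fun_cst.
have hu z : cmod z <= rad -> cmod (h z - u z) < 2 * tol.
  move=> zr; have -> : h z - u z = (un n z - u z) - (un n z1 - u z1) by rewrite /h uz1; ring.
  have := ler_cmodD (un n z - u z) (- (un n z1 - u z1)); rewrite cmodN.
  by have := hN1 z zr; have := hN1 z1 z1rad; lra.
pose O := [set z | exists2 w, trace gamma w & cmod (z - w) < e].
have hO z : cmod z <= rad -> O z -> h z != 0.
  move=> zr [w Ew zw]; have := he w z Ew zw; have := hu z zr.
  rewrite -cmod_gt0; have := ler_cmodD (h z) (- (h z - u z)); rewrite cmodN.
  by rewrite opprB addrC subrK; lra.
have hcirc z : cmod z = rad -> h z != 0.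
  move=> zr; have := hc z zr; have := hu z; rewrite zr lexx => /(_ isT).
  rewrite -cmod_gt0; have := ler_cmodD (h z) (- (h z - u z)); rewrite cmodN.
  by rewrite opprB addrC subrK; lra.
have hz1 : h z1 = 0 by rewrite /h subrr.
have [Q [S hQS]] : rational_off (K n) h.
  by apply: rational_offD => //; exact: rational_off_cst.
have [rs Qrs] := closed_field_poly_normal Q.
have circK z : cmod z = rad -> ~ K n z.
  move=> zr /hN2[w Ew zw]; have := E4 w Ew; have := ler_cmodB z w; lra.
have lc0 : lead_coef Q != 0.
  apply/negP => /eqP l0; pose zc := circle rad 0.
  have zcr : cmod zc = rad by rewrite cmod_circle// ltW.
  have [_ hzc] := hQS zc (circK _ zcr).
  have /negP := hcirc zc zcr; apply; rewrite hzc Qrs l0 scale0r horner0 mul0r.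
  exact: eqxx.
have QE z : Q.[z] = lead_coef Q * \prod_(b <- rs) (z - b).
  rewrite {1}Qrs hornerZ horner_prod; congr (_ * _).
  by apply: eq_bigr => b _; rewrite hornerXsubC.
pose good b := `[< cmod b <= rad /\ ~ O b >].
pose rg := [seq b <- rs | good b].
pose pg z := \prod_(b <- rg) (z - b).
pose T z := lead_coef Q * \prod_(b <- rs | ~~ good b) (z - b).
have QTE z : Q.[z] = pg z * T z.
  by rewrite QE (bigID good)/= /pg big_filter /T mulrCA.
have cprod (r : seq R[i]) (P : pred R[i]) :
    continuous ((fun z => \prod_(b <- r | P b) (z - b)) : C -> C).
  move=> z; elim: r => [|b r IH].
    by under eq_fun do rewrite big_nil; exact: continuous_fun_cst.
  under eq_fun do rewrite big_cons.
  have cb : {for z, continuous (fun z : C => z - b : C)}.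
    apply: (@continuousC_B _ _ z (fun z => z) (fun=> b)); first exact: cvg_id.
    exact: continuous_fun_cst.
  case: (P b); last exact: IH.
  exact: (@continuousC_M _ _ z (fun z => z - b) (fun z => \prod_(j <- r | P j) (z - j)) cb IH).
have cpg : continuous (pg : C -> C) by exact: cprod.
have cT : continuous (T : C -> C).
  move=> z; apply: (@continuousC_M _ _ z (fun=> lead_coef Q)
    (fun z => \prod_(b <- rs | ~~ good b) (z - b))); first exact: continuous_fun_cst.
  exact: cprod.
have pg0 z : pg z = 0 -> z \in rs /\ good z.
  move=> /eqP; rewrite /pg prodf_seq_eq0 => /hasP[b]; rewrite mem_filter => /andP[gb brs].
  by rewrite /= subr_eq0 => /eqP ->.
have cS : continuous ((fun z => S.[z]) : C -> C).
  move=> z; elim/poly_ind: S {hQS} => [|p a IH].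
    by under eq_fun do rewrite horner0; exact: continuous_fun_cst.
  under eq_fun do rewrite hornerMXaddC.
  apply: (@continuousC_D _ _ z (fun z => p.[z] * z) (fun=> a)); last exact: continuous_fun_cst.
  have cid : {for z, continuous (fun z : C => z)} by exact: cvg_id.
  exact: (@continuousC_M _ _ z (fun z => p.[z]) (fun z => z) IH cid).
pose v z := if pg z == 0 then T z / S.[z] else h z / pg z.
have KO z : ~ O z -> ~ K n z.
  by move=> nO /hN2[w Ew zw]; apply: nO; exists w => //; lra.
have cv : continuous (v : C -> C).
  move=> z; have [z0|z0] := eqVneq (pg z) 0.
    (* near a root the function is rational *)
    have [_ /asboolP[zr zO]] := pg0 z z0.
    have nearK w : cmod (w - z) < e / 2 -> ~ K n w.
      move=> wz /hN2[w' Ew ww']; apply: zO; exists w' => //.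
      have := ler_cmodD (z - w) (w - w'); rewrite addrA subrK (cmod_distC z w); lra.
    have nearv : \forall w \near (z : C), v w = T w / S.[w].
      apply/nbhs_cmodP; exists (e / 2) => // w /nearK wK; rewrite /v.
      case: eqP => // /eqP pw; have [s0 ->] := hQS w wK.
      by rewrite QTE mulrAC [pg w * _]mulrC mulfK.
    have [s0 _] := hQS z (KO z zO).
    have cTS : {for z, continuous (fun w : C => T w / S.[w] : C)}.
      apply: (@continuousC_M _ _ z T (fun w => (S.[w])^-1)); first exact: cT.
      exact: (@continuousC_V _ _ z (fun w => S.[w]) s0 (cS z)).
    have vz : v z = T z / S.[z] by rewrite /v z0 eqxx.
    apply/continuous_cmodP => d d0; rewrite vz.
    have /continuous_cmodP/(_ d d0) hd := cTS.
    near=> w; rewrite (_ : v w = T w / S.[w]); first by near: w; exact: hd.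
    by near: w; exact: nearv.
  have nearz : \forall w \near (z : C), pg w != 0.
    have p0 : 0 < cmod (pg z) by rewrite cmod_gt0.
    have /continuous_cmodP/(_ _ p0) := cpg z; apply: filterS => w.
    by apply: contraTneq => ->; rewrite sub0r cmodN ltxx.
  have chp : {for z, continuous (fun w : C => h w / pg w : C)}.
    apply: (@continuousC_M _ _ z h (fun w => (pg w)^-1)); first exact: ch.
    exact: (@continuousC_V _ _ z pg z0 (cpg z)).
  have vz : v z = h z / pg z by rewrite /v (negbTE z0).
  apply/continuous_cmodP => d d0; rewrite vz.
  have /continuous_cmodP/(_ d d0) hd := chp.
  near=> w; rewrite /v ifN; last by near: w; exact: nearz.
  by near: w; exact: hd.
have v0 z : cmod z <= rad -> v z != 0.
  move=> zr; rewrite /v; have [pz|pz] := eqVneq (pg z) 0.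
    have [_ /asboolP[_ zO]] := pg0 z pz; have [s0 _] := hQS z (KO z zO).
    rewrite mulf_neq0 ?invr_eq0// /T mulf_neq0// prodf_seq_neq0.
    apply/allP => b _; apply/implyP; apply: contra; rewrite subr_eq0 => /eqP <-.
    exact/asboolP.
  rewrite mulf_neq0 ?invr_eq0//.
  apply/negP => /eqP hz; have zO : ~ O z by move=> /(hO z zr); rewrite hz eqxx.
  have [s0 hzE] := hQS z (KO z zO).
  have /eqP : Q.[z] = 0 by apply: (mulIf (invr_neq0 s0)); rewrite -hzE hz mul0r.
  rewrite QTE mulf_eq0 (negbTE pz)/= /T mulf_eq0 (negbTE lc0)/=.
  rewrite prodf_seq_eq0 => /hasP[b _ /andP[gb]]; rewrite subr_eq0 => /eqP zb.
  by move: gb; rewrite -zb => /asboolP; apply.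
have hfac z : cmod z = rad -> h z = pg z * v z.
  move=> zr; have pz : pg z != 0.
    apply/negP => /eqP pz; have := hcirc z zr; have [s0 ->] := hQS z (circK z zr).
    by rewrite QTE pz !mul0r eqxx.
  by rewrite /v (negbTE pz) mulrC divfK.
have rgrad : all (fun b => cmod b < rad) rg.
  apply/allP => b; rewrite mem_filter => /andP[/asboolP[br bO] brs].
  rewrite lt_neqAle br andbT; apply/negP => /eqP bre.
  have := hcirc b bre; have [s0 ->] := hQS b (circK b bre).
  by rewrite QE (big_rem b brs)/= subrr mul0r mulr0 mul0r eqxx.
have cratio : continuous ((fun s => h (circle rad s) / u (circle rad s)) : R -> C).
  move=> s; have cc := @continuous_circle R rad s.
  have us : u (circle rad s) != 0 by rewrite ucirc// cmod_circle// ltW.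
  apply: (@continuousC_M _ _ s (fun s => h (circle rad s)) (fun s => (u (circle rad s))^-1)).
    exact: (continuous_compose cc (ch _)).
  exact: (@continuousC_V _ _ s (fun s => u (circle rad s)) us (continuous_compose cc (cu _))).
have harg : has_periodic_arg (fun s => h (circle rad s)).
  apply: (@eq_has_periodic_arg R (fun s => u (circle rad s) * (h (circle rad s) / u (circle rad s)))).
    move=> s _; rewrite mulrC divfK// ucirc// cmod_circle// ltW//.
  apply: has_periodic_argM => //; apply: has_periodic_arg_Re_gt0 => //.
    move=> s _; have sr : cmod (circle rad s) = rad by rewrite cmod_circle// ltW.
    have us := ucirc _ sr.
    apply: Re_gt0_near1.
    rewrite -[X in _ - X](divff us) -mulrBl cmodM cmodV ltr_pdivrMr ?cmod_gt0// mul1r.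
    have := hc _ sr; have := hu (circle rad s); rewrite sr lexx => /(_ isT).
    by lra.
  by rewrite circle01.
have rg0 := disc_no_root rad0 cv v0 rgrad hfac harg.
have z1O : ~ O z1 by move=> /(hO z1 z1rad); rewrite hz1 eqxx.
have [s0 hz1E] := hQS z1 (KO _ z1O).
have /eqP : Q.[z1] = 0 by apply: (mulIf (invr_neq0 s0)); rewrite -hz1E hz1 mul0r.
rewrite QE mulf_eq0 (negbTE lc0)/= prodf_seq_eq0 => /hasP[b brs /=].
rewrite subr_eq0 => /eqP z1b.
have : z1 \in rg by rewrite mem_filter z1b brs andbT -z1b; apply/asboolP.
by rewrite rg0.
Unshelve. all: by end_near. Qed.

End ZeroFree.

(** * Polynomials in several variables *)


Import (canonicals) mpoly.

Section MultivariatePolynomials.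
Variable R : realType.
Local Notation C := (R[i]^o).

(** Evaluating a polynomial along a map into affine space only uses ring
    operations on its coordinates. *)
Lemma peval_closed (T : Type) (N : nat) (P : (T -> R[i]) -> Prop) (G : T -> CN R N) :
  (forall c, P (fun=> c)) ->
  (forall g h, P g -> P h -> P (fun t => g t + h t)) ->
  (forall g h, P g -> P h -> P (fun t => g t * h t)) ->
  (forall i, P (fun t => G t ord0 i : R[i])) ->
  forall p, P (fun t => peval p (G t)).
Proof.
move=> Pc PD PM PG p.
have Pprod (r : seq 'I_N) (F : 'I_N -> T -> R[i]) : (forall i, P (F i)) ->
    P (fun t => \prod_(i <- r) F i t).
  move=> PF; elim: r => [|i r IHr].
    by under eq_fun do rewrite big_nil; exact: Pc.
  by under eq_fun do rewrite big_cons; exact: PM.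
have Pexp (h : T -> R[i]) k : P h -> P (fun t => h t ^+ k).
  move=> Ph; elim: k => [|k IHk].
    by under eq_fun do rewrite expr0; exact: Pc.
  by under eq_fun do rewrite exprS; exact: PM.
have -> : (fun t => peval p (G t)) = (fun t => \sum_(m <- mpoly.msupp p)
    mpoly.mcoeff m p * \prod_i (G t ord0 i : R[i]) ^+ mpoly.fun_of_multinom m i).
  by apply/funext => t; rewrite /peval mpoly.mevalE.
elim: (mpoly.msupp p) => [|m s IH].
  by under eq_fun do rewrite big_nil; exact: Pc.
under eq_fun do rewrite big_cons.
apply: PD => //; apply: PM; first exact: Pc.
by apply: Pprod => i; apply: Pexp; exact: PG.
Qed.

Definition is_poly_map (N : nat) (h : CN R N -> R[i]) :=
  exists p : mpoly.mpoly N R[i], forall x, peval p x = h x.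

Lemma is_poly_map_cst N (c : R[i]) : is_poly_map (fun _ : CN R N => c).
Proof. by exists (mpoly.mpolyC N c) => x; rewrite /peval mpoly.mevalC. Qed.

Lemma is_poly_map_coord N i : is_poly_map (fun x : CN R N => x ord0 i : R[i]).
Proof. by exists (mpoly.mpolyX R[i] (mpoly.mnm1 i)) => x; rewrite /peval mpoly.mevalXU. Qed.

Lemma is_poly_mapD N (g h : CN R N -> R[i]) :
  is_poly_map g -> is_poly_map h -> is_poly_map (fun x => g x + h x).
Proof. by move=> [p hp] [q hq]; exists (p + q) => x; rewrite -hp -hq /peval mpoly.mevalD. Qed.

Lemma is_poly_mapM N (g h : CN R N -> R[i]) :
  is_poly_map g -> is_poly_map h -> is_poly_map (fun x => g x * h x).
Proof. by move=> [p hp] [q hq]; exists (p * q) => x; rewrite -hp -hq /peval mpoly.mevalM. Qed.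

Lemma is_poly_mapB N (g h : CN R N -> R[i]) :
  is_poly_map g -> is_poly_map h -> is_poly_map (fun x => g x - h x).
Proof. by move=> [p hp] [q hq]; exists (p - q) => x; rewrite -hp -hq /peval mpoly.mevalB. Qed.

Lemma is_poly_map_horner N (q : {poly R[i]}) (h : CN R N -> R[i]) :
  is_poly_map h -> is_poly_map (fun x => q.[h x]).
Proof.
move=> ph; elim/poly_ind: q => [|q c IH].
  by under eq_fun do rewrite horner0; exact: is_poly_map_cst.
under eq_fun do rewrite hornerMXaddC.
by apply: is_poly_mapD; [exact: is_poly_mapM|exact: is_poly_map_cst].
Qed.

Lemma poly_hull_le N (X : set (CN R N)) (h : CN R N -> R[i]) (x : CN R N) (M : R) :
  X !=set0 -> is_poly_map h -> poly_hull X x ->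
  (forall y, X y -> cmod (h y) <= M) -> cmod (h x) <= M.
Proof.
move=> X0 [p hp] xX hM; rewrite -hp (le_trans (xX p))//.
apply: ge_sup => [|_ [y Xy <-]]; last by rewrite hp; exact: hM.
by case: X0 => y Xy; exists (cmod (peval p y)); exists y.
Qed.

Lemma continuous_CN (T : topologicalType) (N : nat) (G : T -> CN R N) (t : T) :
  (forall i, {for t, continuous (fun u => G u ord0 i : C)}) ->
  {for t, continuous G}.
Proof.
move=> cG A [P nP sPA].
have : \forall u \near t, forall i, P ord0 i (G u ord0 i).
  by apply: filter_forall => i; apply: cG; exact: nP.
by apply: filterS => u hu; apply: sPA => i j; rewrite ord1.
Qed.

End MultivariatePolynomials.

(** * The arc in three-space *)

Section ThreeSpace.
Variable R : realType.
Local Notation C := (R[i]^o).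
Implicit Types (s : R) (z w : R[i]).

Definition vec3 (a b c : R[i]) : CN R 3 := \row_i nth 0 [:: a; b; c] i.

Lemma vec3_coords (x : CN R 3) : exists a b c, x = vec3 a b c.
Proof.
exists (x ord0 (inord 0)), (x ord0 (inord 1)), (x ord0 (inord 2)).
apply/rowP => j; rewrite mxE; case: j => [[|[|[|//]]] h] /=;
  by congr (x _ _); apply: val_inj; rewrite /= inordK.
Qed.

Definition sqnorm3 (a b c : R[i]) : R := cmod a ^+ 2 + cmod b ^+ 2 + cmod c ^+ 2.

Lemma vec3_ball a b c : closed_unit_ball R 3 (vec3 a b c) <-> sqnorm3 a b c <= 1.
Proof.
rewrite /closed_unit_ball/= /enorm !big_ord_recl big_ord0 !mxE/= addr0 addrA.
by rewrite -/(sqnorm3 a b c) -[X in _ <= X](@sqrtr1 R) ler_sqrt.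
Qed.

Definition ix0 : 'I_3 := ord0.
Definition ix1 : 'I_3 := inord 1.
Definition ix2 : 'I_3 := inord 2.

Lemma vec3_0 a b c : vec3 a b c ord0 ix0 = a.
Proof. by rewrite mxE. Qed.
Lemma vec3_1 a b c : vec3 a b c ord0 ix1 = b.
Proof. by rewrite mxE inordK. Qed.
Lemma vec3_2 a b c : vec3 a b c ord0 ix2 = c.
Proof. by rewrite mxE inordK. Qed.

Lemma peval_vec3_closed (T : Type) (P : (T -> R[i]) -> Prop) (a b c : T -> R[i]) :
  (forall k, P (fun=> k)) ->
  (forall g h, P g -> P h -> P (fun t => g t + h t)) ->
  (forall g h, P g -> P h -> P (fun t => g t * h t)) ->
  P a -> P b -> P c -> forall p, P (fun t => peval p (vec3 (a t) (b t) (c t))).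
Proof.
move=> Pc PD PM Pa Pb Pc'; apply: peval_closed => // i.
have -> : (fun t => vec3 (a t) (b t) (c t) ord0 i) =
          (fun t => nth 0 [:: a t; b t; c t] i) by apply/funext => t; rewrite mxE.
by case: i => [[|[|[|//]]] h].
Qed.

Lemma continuous_peval_vec3 (T : topologicalType) (a b c : T -> R[i]) p :
  continuous (a : T -> C) -> continuous (b : T -> C) -> continuous (c : T -> C) ->
  continuous ((fun t => peval p (vec3 (a t) (b t) (c t))) : T -> C).
Proof.
move=> ca cb cc.
pose P (g : T -> R[i]) := forall t, {for t, continuous (g : T -> C)}.
have Pc k : P (fun=> k) by move=> t; exact: continuous_fun_cst.
have PD g h : P g -> P h -> P (fun t => g t + h t).
  by move=> cg ch t; exact: (continuousC_D (cg t) (ch t)).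
have PM g h : P g -> P h -> P (fun t => g t * h t).
  by move=> cg ch t; exact: (continuousC_M (cg t) (ch t)).
exact: (peval_vec3_closed Pc PD PM ca cb cc p).
Qed.

(** The ball is star-shaped, so a polynomial without zeros on it has a continuous
    argument along every loop in it. *)
Lemma ball_loop_periodic_arg (a b c : R -> R[i]) p :
  continuous (a : R -> C) -> continuous (b : R -> C) -> continuous (c : R -> C) ->
  (forall s, 0 <= s <= 1 -> closed_unit_ball R 3 (vec3 (a s) (b s) (c s))) ->
  (forall x, closed_unit_ball R 3 x -> peval p x != 0) ->
  vec3 (a 0) (b 0) (c 0) = vec3 (a 1) (b 1) (c 1) ->
  has_periodic_arg (fun s => peval p (vec3 (a s) (b s) (c s))).
Proof.
move=> ca cb cc inball p0 loop.
have abc : [/\ a 0 = a 1, b 0 = b 1 & c 0 = c 1].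
  split; [move/(congr1 (fun x : CN R 3 => x ord0 ix0)): loop; rewrite !vec3_0
         |move/(congr1 (fun x : CN R 3 => x ord0 ix1)): loop; rewrite !vec3_1
         |move/(congr1 (fun x : CN R 3 => x ord0 ix2)): loop; rewrite !vec3_2]; exact: id.
have scaled (g : R -> R[i]) : continuous (g : R -> C) ->
    continuous ((fun q : R * R => q.1%:C * g q.2) : R * R -> C).
  move=> cg q; apply: (@continuousC_M _ _ q (fun q : R * R => q.1%:C) (fun q : R * R => g q.2)).
    exact: (@continuousC_real _ _ q (fun q : R * R => q.1) (@continuous_fst2 _ _ q)).
  exact: (@continuous_compose _ _ _ (fun q : R * R => q.2) (g : R -> C) q
    (@continuous_snd2 _ _ q) (cg _)).
have [||s sI|th [cth hth pth]] := @arg_lift R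
    (fun t s => peval p (vec3 (t%:C * a s) (t%:C * b s) (t%:C * c s))).
- exact: (@continuous_peval_vec3 (R * R)%type _ _ _ p (scaled _ ca) (scaled _ cb) (scaled _ cc)).
- move=> t s /andP[t0 t1] sI; apply: p0; apply/vec3_ball.
  have /vec3_ball := inball s sI; rewrite /sqnorm3 !cmodM !cmod_real ger0_norm// !exprMn.
  rewrite -!mulrDr; set X := (X in X <= 1 -> _) => X1.
  rewrite (@le_trans _ _ (t ^+ 2 * 1))//; last by rewrite mulr1 expr_le1.
  by apply: ler_wpM2l; rewrite ?sqr_ge0.
- by rewrite !mul0r.
exists th; split=> //.
- apply: pth; rewrite ?lexx ?ler01// => t _; have [-> -> ->] := abc; exact: erefl.
- by move=> s sI; have := hth s sI; rewrite !mul1r.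
Qed.

Variables (gamma : R -> R[i]) (f : R[i] -> R[i]) (fn : nat -> R[i] -> R[i])
  (K : nat -> set R[i]).
Hypothesis gamma_cont : continuous (gamma : R -> C).
Hypothesis gamma_inj : forall s t, 0 <= s <= 1 -> 0 <= t <= 1 ->
  gamma s = gamma t -> s = t.
Hypothesis trace_le4 : forall z, trace gamma z -> cmod z <= 4.
Hypothesis fn_cont : forall n, continuous (fn n : C -> C).
Hypothesis f_cont : continuous (f : C -> C).
Hypothesis fn_f : forall e : R, 0 < e -> exists N, forall n, (N <= n)%N ->
  forall z, cmod (fn n z - f z) < e.
Hypothesis f_bounded : exists2 M : R, 0 < M & forall z, cmod (f z) <= M.
Hypothesis f_infty : forall z, 5 <= cmod z -> cmod (z * f z - 1) <= 4000 / cmod z.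
Hypothesis fn_rat : forall n, rational_off (K n) (fn n).
Hypothesis K_off : forall n z, K n z -> ~ trace gamma z.
Hypothesis K_near : forall e : R, 0 < e -> exists N, forall n, (N <= n)%N ->
  forall z, K n z -> exists2 w, trace gamma w & cmod (z - w) < e.

Let rad : R := 4000 * 40.
Let scale : R[i] := ((2 * rad)^-1)%:C.

Lemma rad_gt0 : 0 < rad. Proof. by rewrite /rad; lra. Qed.

Lemma scale_neq0 : scale != 0.
Proof.
rewrite -cmod_gt0 cmod_real normr_gt0 invr_neq0// gt_eqF// mulr_gt0//.
exact: rad_gt0.
Qed.

Lemma cmod_scale z : cmod (scale * z) = cmod z / (2 * rad).
Proof.
rewrite cmodM cmod_real ger0_norm 1?mulrC// invr_ge0 mulr_ge0//.
exact/ltW/rad_gt0.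
Qed.

(** The factor 16 pushes the arc off the ball: [f z] and [z * f z - 1] have no
    common zero. Both vanish at infinity, so a large circle stays in the ball. *)
Definition disc_map z : CN R 3 := vec3 (scale * z) (16 * f z) (16 * (z * f z - 1)).

Definition arc3 : set (CN R 3) := [set disc_map z | z in trace gamma].

Definition disc_sqnorm z : R := sqnorm3 (scale * z) (16 * f z) (16 * (z * f z - 1)).

Lemma cmod16 z : cmod (16 * z) = 16 * cmod z.
Proof.
rewrite cmodM (_ : (16 : R[i]) = (16%:R)%:C); last by rewrite rmorph_nat.
by rewrite cmod_real normr_nat.
Qed.

Lemma disc_sqnorm_trace z : trace gamma z -> 4 <= disc_sqnorm z.
Proof.
move=> /trace_le4 z4; rewrite /disc_sqnorm /sqnorm3 !cmod16.
have h0 := sqr_ge0 (cmod (scale * z)).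
have [h|h] := leP (1 / 8) (cmod (f z)).
  by have := sqr_ge0 (16 * cmod (z * f z - 1)); nra.
have h1 : 1 / 2 <= cmod (z * f z - 1).
  have := ler_cmodB 1 (z * f z); rewrite cmod1 cmod_distC cmodM.
  have : cmod z * cmod (f z) <= 4 * (1 / 8) by apply: ler_pM; rewrite ?cmod_ge0// ltW.
  by lra.
by have := sqr_ge0 (16 * cmod (f z)); nra.
Qed.

Lemma disc_sqnorm_circle z : cmod z = rad -> disc_sqnorm z <= 1.
Proof.
move=> zr; have r0 := rad_gt0.
have r5 : 5 <= cmod z by rewrite zr /rad; lra.
have := f_infty r5; rewrite zr.
have -> : 4000 / rad = 1 / 40 by rewrite /rad; field.
move=> h1; rewrite /disc_sqnorm /sqnorm3 !cmod16 cmod_scale zr.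
have -> : rad / (2 * rad) = 1 / 2 by field; rewrite gt_eqF.
have h2 : cmod (f z) <= 1 / 40.
  have := ler_cmodD (z * f z - 1) 1; rewrite subrK cmod1 cmodM zr => h2.
  have : rad * cmod (f z) <= rad * (1 / 40) by rewrite [in leRHS]/rad; lra.
  by rewrite ler_pM2l.
have := cmod_ge0 (f z); have := cmod_ge0 (z * f z - 1); nra.
Qed.

Lemma f_poly_approx : poly_approx (trace gamma) f.
Proof.
apply: poly_approx_lim => e e0; have [N hN] := fn_f e0.
exists (fn N); last by move=> z _; rewrite cmod_distC ltW// hN.
have [Q [S hQS]] := fn_rat N.
apply: (poly_approx_rational gamma_cont gamma_inj (Q := Q) (S := S)) => z Ez.
by apply: hQS => /K_off.
Qed.

Lemma trace_nonempty : trace gamma (gamma 0).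
Proof. by exists 0 => //=; rewrite lexx ler01. Qed.

Lemma arc3_is_arc : is_arc arc3.
Proof.
have c1 : continuous ((fun s => scale * gamma s) : R -> C).
  move=> s; apply: (@continuousC_M _ _ s (fun=> scale) gamma); last exact: gamma_cont.
  exact: continuous_fun_cst.
have c2 : continuous ((fun s => f (gamma s)) : R -> C).
  by move=> s; exact: (@continuous_compose R C C gamma f s (@gamma_cont s) (@f_cont _)).
have cF : continuous (fun s => disc_map (gamma s)).
  move=> s; apply: continuous_CN => i.
  have -> : (fun u => disc_map (gamma u) ord0 i) = (fun u => nth 0 [:: scale * gamma u;
      16 * f (gamma u); 16 * (gamma u * f (gamma u) - 1)] i).
    by apply/funext => u; rewrite mxE.
  have c3 : {for s, continuous (fun s => 16 * f (gamma s) : C)}.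
    exact: (continuousC_M (@continuous_fun_cst R C 16 s) (c2 s)).
  have c4 : {for s, continuous (fun s => 16 * (gamma s * f (gamma s) - 1) : C)}.
    exact: (continuousC_M (@continuous_fun_cst R C 16 s) (continuousC_B
      (continuousC_M (@gamma_cont s) (c2 s)) (@continuous_fun_cst R C 1 s))).
  case: i => [[|[|[|k]]] h]; [exact: (c1 s)|exact: c3|exact: c4|].
  by exfalso; move: h; rewrite !ltnS ltn0.
pose back (x : CN R 3) := arc_parameter gamma (x ord0 ix0 / scale).
have backK s : 0 <= s <= 1 -> back (disc_map (gamma s)) = s.
  move=> sI; rewrite /back vec3_0 [scale * _]mulrC mulfK ?scale_neq0//.
  exact: arc_parameterK.
exists (fun s => disc_map (gamma s)), back; split.
- split; first exact: continuous_subspaceT.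
  apply/subspace_continuousP => _ [_ [s0 s0I <-] <-].
  apply/cvgrPdist_lt => e e0.
  have [d d0 hd] := arc_parameter_continuous gamma_cont gamma_inj s0I e0.
  have cx : {for disc_map (gamma s0), continuous (fun x : CN R 3 => x ord0 ix0 / scale : C)}.
    exact: (continuousC_M (@coord_continuous _ 1 3 ord0 ix0 _)
      (@continuous_fun_cst (CN R 3) C scale^-1 _)).
  rewrite near_withinE; have /continuous_cmodP/(_ d d0) := cx.
  apply: filterS => y /= hy [w [s sI sw] wy]; move: hy; rewrite -wy -sw.
  rewrite /from_subspace !backK// !vec3_0 ![scale * _]mulrC !mulfK ?scale_neq0//.
  by move=> h; rewrite distrC; exact: hd.
- by move=> s /=; rewrite in_itv/= => sI; exists (gamma s) => //; exists s.
- by move=> _ [_ [s sI <-] <-]; rewrite /= in_itv/= backK.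
- by move=> s; rewrite inE/= in_itv/= => sI; exact: backK.
- by move=> _ /set_mem[_ [s sI <-] <-]; rewrite backK.
Qed.

(** A point of the hull lies over [E], since a polynomial close to [(w - z)^-1] on
    [E] would separate it. Its second coordinate is then determined by polynomials
    close to [f] on [E], and its third one by a polynomial relation. *)
Lemma arc3_poly_convex : poly_convex arc3.
Proof.
have J0 : arc3 !=set0 by exists (disc_map (gamma 0)); exists (gamma 0) => //; exact: trace_nonempty.
apply/seteqP; split=> [x xJ|_ [_ [s sI <-] <-] p]; last first.
  have cp : continuous ((fun s => peval p (disc_map (gamma s))) : R -> C).
    apply: continuous_peval_vec3 => t.
    - exact: (continuousC_M (@continuous_fun_cst R C scale t) (@gamma_cont t)).
    - exact: (continuousC_M (@continuous_fun_cst R C 16 t)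
        (@continuous_compose R C C gamma f t (@gamma_cont t) (@f_cont _))).
    - exact: (continuousC_M (@continuous_fun_cst R C 16 t) (continuousC_B
        (continuousC_M (@gamma_cont t) (@continuous_compose R C C gamma f t (@gamma_cont t) (@f_cont _)))
        (@continuous_fun_cst R C 1 t))).
  have [M M0 hM] := trace_bounded cp.
  apply: ub_le_sup; last by exists (disc_map (gamma s)) => //; exists (gamma s) => //; exists s.
  exists M => _ [_ [_ [t tI <-] <-] <-]; apply: hM.
  by exists t.
have [z [b [c xE]]] : exists z b c, x = vec3 (scale * z) b c.
  have [a [b [c ->]]] := vec3_coords x; exists (a / scale), b, c.
  by rewrite mulrC divfK ?scale_neq0.
have pz : is_poly_map (fun y : CN R 3 => y ord0 ix0 * scale^-1).
  by apply: is_poly_mapM; [exact: is_poly_map_coord|exact: is_poly_map_cst].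
have zE w b' c' : vec3 (scale * w) b' c' ord0 ix0 * scale^-1 = w.
  by rewrite vec3_0 mulrC mulrA mulVf ?scale_neq0// mul1r.
have Ez : trace gamma z.
  apply: contrapT => nEz.
  pose D := 4 + cmod z; have D0 : 0 < D by have := cmod_ge0 z; rewrite /D; lra.
  have D2 : 0 < (2 * D)^-1 by rewrite invr_gt0 mulr_gt0.
  have [q hq] := poly_approx_pole gamma_cont gamma_inj nEz D2.
  pose h (y : CN R 3) := 1 - (y ord0 ix0 * scale^-1 - z) * q.[y ord0 ix0 * scale^-1].
  have ph : is_poly_map h.
    apply: is_poly_mapB; first exact: is_poly_map_cst.
    apply: is_poly_mapM; last exact: is_poly_map_horner.
    by apply: is_poly_mapB => //; exact: is_poly_map_cst.
  have := poly_hull_le (M := 1 / 2) J0 ph xJ.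
  rewrite xE /h zE subrr mul0r subr0 cmod1 => H.
  suff : (1 : R) <= 1 / 2 by lra.
  apply: H => _ [w Ew <-]; rewrite zE.
  have wz : w - z != 0 by rewrite subr_eq0; apply: contra_not_neq nEz => <-.
  have -> : 1 - (w - z) * q.[w] = (w - z) * ((w - z)^-1 - q.[w]).
    by rewrite mulrBr divff.
  rewrite cmodM; have h1 := hq w Ew.
  have h2 : cmod (w - z) <= D.
    by have := ler_cmodD w (- z); rewrite cmodN /D; have := trace_le4 Ew; lra.
  apply: (@le_trans _ _ (D * (2 * D)^-1)).
    by apply: ler_pM; rewrite ?cmod_ge0// ltW.
  by rewrite le_eqVlt; apply/orP; left; apply/eqP; field; rewrite gt_eqF.
have bE : b = 16 * f z.
  apply/eqP; rewrite -subr_eq0 -cmod_eq0 eq_le cmod_ge0 andbT.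
  apply/ler_addgt0Pr => e e0; rewrite add0r.
  have e32 : 0 < e / 32 by rewrite divr_gt0.
  have [q hq] := f_poly_approx e32.
  pose h (y : CN R 3) := y ord0 ix1 - 16 * q.[y ord0 ix0 * scale^-1].
  have ph : is_poly_map h.
    apply: is_poly_mapB; first exact: is_poly_map_coord.
    apply: is_poly_mapM; first exact: is_poly_map_cst.
    exact: is_poly_map_horner.
  have := poly_hull_le (M := e / 2) J0 ph xJ; rewrite xE /h zE vec3_1 => H.
  have h1 : cmod (b - 16 * q.[z]) <= e / 2.
    apply: H => _ [w Ew <-]; rewrite zE vec3_1 -mulrBr cmod16.
    by have := hq w Ew; lra.
  have -> : b - 16 * f z = (b - 16 * q.[z]) + - (16 * (f z - q.[z])) by ring.
  have := ler_cmodD (b - 16 * q.[z]) (- (16 * (f z - q.[z]))).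
  by rewrite cmodN cmod16; have := hq z Ez; lra.
have cE : c = 16 * (z * f z - 1).
  pose h (y : CN R 3) := y ord0 ix2 - (y ord0 ix0 * scale^-1 * y ord0 ix1 - 16).
  have ph : is_poly_map h.
    apply: is_poly_mapB; first exact: is_poly_map_coord.
    apply: is_poly_mapB; last exact: is_poly_map_cst.
    by apply: is_poly_mapM => //; exact: is_poly_map_coord.
  have := poly_hull_le (M := 0) J0 ph xJ; rewrite xE /h zE vec3_1 vec3_2 bE => H.
  have h0 : cmod (c - (z * (16 * f z) - 16)) <= 0.
    apply: H => _ [w Ew <-]; rewrite zE vec3_1 vec3_2.
    have -> : 16 * (w * f w - 1) - (w * (16 * f w) - 16) = 0 :> R[i] by ring.
    by rewrite cmod0.
  have /eqP : c - (z * (16 * f z) - 16) == 0.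
    by rewrite -cmod_eq0 eq_le h0 cmod_ge0.
  by move/eqP; rewrite subr_eq0 => /eqP ->; ring.
by exists z => //; rewrite xE bE cE.
Qed.

Lemma arc3_off_ball : arc3 `&` closed_unit_ball R 3 = set0.
Proof.
apply/seteqP; split=> // _ [[z Ez <-]] /vec3_ball.
by have := disc_sqnorm_trace Ez; rewrite /disc_sqnorm => h1 h2; lra.
Qed.

(** Every polynomial vanishing at a point of the disc vanishes on the arc or on
    the ball: argument principle for its pullback under [disc_map]. *)
Lemma disc_map_zero p z : cmod z <= rad -> peval p (disc_map z) = 0 ->
  exists2 x, (closed_unit_ball R 3 `|` arc3) x & peval p x = 0.
Proof.
move=> zr pz; apply: contrapT => none.
have pball x : closed_unit_ball R 3 x -> peval p x != 0.
  by move=> Bx; apply/eqP => px; apply: none; exists x => //; left.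
have parc w : trace gamma w -> peval p (disc_map w) != 0.
  move=> Ew; apply/eqP => px; apply: none; exists (disc_map w) => //.
  by right; exists w.
have r0 := rad_gt0.
have circ_ball w : cmod w = rad -> closed_unit_ball R 3 (disc_map w).
  by move=> wr; apply/vec3_ball; exact: disc_sqnorm_circle.
pose u w := peval p (disc_map w).
pose un n w := peval p (vec3 (scale * w) (16 * fn n w) (16 * (w * fn n w - 1))).
have cpoly (g : R[i] -> R[i]) : continuous (g : C -> C) -> continuous
    ((fun w => peval p (vec3 (scale * w) (16 * g w) (16 * (w * g w - 1)))) : C -> C).
  move=> cg; have cid : continuous ((fun w : C => w) : C -> C) by move=> w; exact: cvg_id.
  apply: continuous_peval_vec3 => w.
  - exact: (continuousC_M (@continuous_fun_cst C C scale w) (cid w)).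
  - exact: (continuousC_M (@continuous_fun_cst C C 16 w) (cg w)).
  - exact: (continuousC_M (@continuous_fun_cst C C 16 w) (continuousC_B
      (continuousC_M (cid w) (cg w)) (@continuous_fun_cst C C 1 w))).
suff : u z != 0 by rewrite /u pz eqxx.
have rad5 : 5 <= rad by rewrite /rad; lra.
have cu : continuous (u : C -> C) := cpoly f f_cont.
have cun n : continuous (un n : C -> C) := cpoly (fn n) (@fn_cont n).
have unif : forall e : R, 0 < e -> exists N, forall n, (N <= n)%N ->
    forall w, cmod w <= rad -> cmod (un n w - u w) < e.
  (* [None] stands for the limit: uniform convergence and boundedness together are
     preserved by ring operations *)
  pose F (q : option nat * R[i]) := if q.1 is Some n then fn n q.2 else f q.2.
  pose P (g : option nat * R[i] -> R[i]) :=
    (exists2 M : R, 0 < M & forall w, cmod w <= rad -> cmod (g (None, w)) <= M) /\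
    (forall e : R, 0 < e -> exists N, forall n, (N <= n)%N ->
      forall w, cmod w <= rad -> cmod (g (Some n, w) - g (None, w)) < e).
  have Pc k : P (fun=> k).
    split; first by exists (1 + cmod k) => [|w _]; have := cmod_ge0 k; lra.
    by move=> e e0; exists 0%N => n _ w _; rewrite subrr cmod0.
  have PD g h : P g -> P h -> P (fun q => g q + h q).
    move=> [[M1 M10 hM1] h1] [[M2 M20 hM2] h2]; split.
      exists (M1 + M2) => [|w wr]; first exact: addr_gt0.
      by rewrite (le_trans (ler_cmodD _ _))// lerD ?hM1 ?hM2.
    move=> e e0; have e2 : 0 < e / 2 by rewrite divr_gt0.
    have [N1 H1] := h1 _ e2; have [N2 H2] := h2 _ e2; exists (maxn N1 N2) => n.
    rewrite geq_max => /andP[n1 n2] w wr; rewrite opprD addrACA (splitr e).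
    by rewrite (le_lt_trans (ler_cmodD _ _))// ltrD ?H1 ?H2.
  have PM g h : P g -> P h -> P (fun q => g q * h q).
    move=> [[M1 M10 hM1] h1] [[M2 M20 hM2] h2]; split.
      exists (M1 * M2) => [|w wr]; first exact: mulr_gt0.
      by rewrite cmodM ler_pM ?cmod_ge0 ?hM1 ?hM2.
    move=> e e0.
    have e2 : 0 < e / 2 / (M2 + 1) by rewrite !divr_gt0// addr_gt0.
    have e1 : 0 < e / 2 / M1 by rewrite !divr_gt0.
    have [N1 H1] := h1 _ e2; have [N2 H2] := h2 _ e1; have [N3 H3] := h2 _ ltr01.
    exists (maxn N1 (maxn N2 N3)) => n; rewrite !geq_max => /and3P[n1 n2 n3] w wr.
    have -> : g (Some n, w) * h (Some n, w) - g (None, w) * h (None, w) =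
      (g (Some n, w) - g (None, w)) * h (Some n, w) +
      g (None, w) * (h (Some n, w) - h (None, w)) by ring.
    rewrite (le_lt_trans (ler_cmodD _ _))// !cmodM (splitr e) ltr_leD//.
      have hb : cmod (h (Some n, w)) <= M2 + 1.
        have := ler_cmodD (h (None, w)) (h (Some n, w) - h (None, w)).
        by rewrite addrC subrK; have := H3 n n3 w wr; have := hM2 w wr; lra.
      apply: (@le_lt_trans _ _ (cmod (g (Some n, w) - g (None, w)) * (M2 + 1))).
        by apply: ler_wpM2l; rewrite ?cmod_ge0.
      by rewrite -ltr_pdivlMr ?H1// addr_gt0.
    apply: (@le_trans _ _ (M1 * (e / 2 / M1))).
      by apply: ler_pM; rewrite ?cmod_ge0 ?hM1// ltW// H2.
    by rewrite mulrC divfK// gt_eqF.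
  have Pz : P (fun q => q.2).
    split; first by exists rad.
    by move=> e e0; exists 0%N => n _ w _; rewrite subrr cmod0.
  have PF : P F.
    split; last by move=> e e0; have [N hN] := fn_f e0; exists N => n Nn w _; exact: hN.
    by have [M M0 hM] := f_bounded; exists M => // w _; exact: hM.
  have PN1 : P (fun=> - 1) by exact: Pc.
  have [_ H] := @peval_vec3_closed _ P (fun q => scale * q.2) (fun q => 16 * F q)
    (fun q => 16 * (q.2 * F q + - 1)) Pc PD PM (PM _ _ (Pc scale) Pz)
    (PM _ _ (Pc 16) PF) (PM _ _ (Pc 16) (PD _ _ (PM _ _ Pz PF) PN1)) p.
  exact: H.
have rat n : rational_off (K n) (un n).
  have Pc := @rational_off_cst R (K n); have PM := @rational_offM R (K n).
  have Pz : rational_off (K n) (fun w => w).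
    by apply: eq_rational_off (rational_off_poly _ 'X) => w; rewrite hornerX.
  exact: (peval_vec3_closed Pc (@rational_offD R (K n)) PM (PM _ _ (Pc _) Pz)
    (PM _ _ (Pc _) (fn_rat n))
    (PM _ _ (Pc _) (rational_offD (PM _ _ Pz (fn_rat n)) (Pc _))) p).
have ucirc w : cmod w = rad -> u w != 0 by move=> /circ_ball; exact: pball.
have parg : has_periodic_arg (fun s => u (circle rad s)).
  have cc s := @continuous_circle R rad s.
  have cfc s : {for s, continuous (fun s => f (circle rad s) : C)}.
    exact: (@continuous_compose R C C (circle rad) f s (cc s) (@f_cont _)).
  apply: (@ball_loop_periodic_arg (fun s => scale * circle rad s)
    (fun s => 16 * f (circle rad s)) (fun s => 16 * (circle rad s * f (circle rad s) - 1)) p).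
  + by move=> s; exact: (continuousC_M (@continuous_fun_cst R C scale s) (cc s)).
  + by move=> s; exact: (continuousC_M (@continuous_fun_cst R C 16 s) (cfc s)).
  + by move=> s; exact: (continuousC_M (@continuous_fun_cst R C 16 s) (continuousC_B
      (continuousC_M (cc s) (cfc s)) (@continuous_fun_cst R C 1 s))).
  + by move=> s _; apply: circ_ball; rewrite cmod_circle// ltW.
  + exact: pball.
  + by rewrite circle01.
exact: (zero_free_limit gamma_cont rad5 trace_le4 cu cun unif rat K_near parc ucirc parg zr).
Qed.

(** On a path from the circle to the arc the squared norm passes from at most 1
    to at least 4. *)
Lemma disc_leaves_arc_and_ball : exists z, [/\ cmod z <= 4000 * 40,
  ~ closed_unit_ball R 3 (disc_map z) & ~ arc3 (disc_map z)].
Proof.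
have r0 := rad_gt0.
pose path s : R[i] := gamma 0 + (clamp s)%:C * (rad%:C - gamma 0).
have cpath : continuous (path : R -> C).
  move=> s; have ccl : {for s, continuous (fun s => (clamp s)%:C : C)}.
    exact: (@continuousC_real _ _ s (@clamp R) (@continuous_clamp R s)).
  exact: (continuousC_D (@continuous_fun_cst R C (gamma 0) s)
    (continuousC_M ccl (@continuous_fun_cst R C (rad%:C - gamma 0) s))).
have cnorm : continuous (fun s => disc_sqnorm (path s)).
  move=> s; have cp := cpath s.
  have cfp : {for s, continuous (fun s => f (path s) : C)}.
    exact: (@continuous_compose R C C path f s cp (@f_cont _)).
  have sq (g : R -> R[i]) : {for s, continuous (g : R -> C)} ->
      {for s, continuous (fun s => cmod (g s) ^+ 2)}.
    by move=> cgg; have cc := continuousC_cmod cgg; exact: (cvgM cc cc).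
  have h1 := sq _ (continuousC_M (@continuous_fun_cst R C scale s) cp).
  have h2 := sq _ (continuousC_M (@continuous_fun_cst R C 16 s) cfp).
  have h3 := sq _ (continuousC_M (@continuous_fun_cst R C 16 s)
    (continuousC_B (continuousC_M cp cfp) (@continuous_fun_cst R C 1 s))).
  exact: (cvgD (cvgD h1 h2) h3).
have p0 : path 0 = gamma 0 by rewrite /path clamp_le0// mul0r addr0.
have p1 : path 1 = rad%:C by rewrite /path clamp_ge1// mul1r addrC subrK.
have n0 : 4 <= disc_sqnorm (path 0) by rewrite p0; exact/disc_sqnorm_trace/trace_nonempty.
have n1 : disc_sqnorm (path 1) <= 1.
  by rewrite p1; apply: disc_sqnorm_circle; rewrite cmod_real gtr0_norm.
have [s _ hs] : exists2 s, s \in `[0, 1] & disc_sqnorm (path s) = 2.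
  apply: IVT; first exact: ler01.
    exact: continuous_subspaceT.
  by rewrite ge_min le_max; apply/andP; split; apply/orP; [right|left]; lra.
exists (path s); split.
- have /andP[s0 s1] := clamp_itv s.
  have -> : path s = (1 - clamp s)%:C * gamma 0 + (clamp s)%:C * rad%:C.
    by rewrite /path rmorphB/= rmorph1; ring.
  have g4 := trace_le4 trace_nonempty.
  rewrite (le_trans (ler_cmodD _ _))// !cmodM !cmod_real !ger0_norm ?subr_ge0//; last exact: ltW.
  have : (1 - clamp s) * cmod (gamma 0) <= (1 - clamp s) * rad.
    by apply: ler_wpM2l; [rewrite subr_ge0|rewrite /rad; lra].
  by rewrite -/rad; lra.
- by move=> /vec3_ball; rewrite -/(disc_sqnorm _) hs; lra.
- move=> [w Ew e]; have := disc_sqnorm_trace Ew.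
  have /(congr1 (fun x : CN R 3 => [/\ x ord0 ix0 = scale * path s,
    x ord0 ix1 = 16 * f (path s) & x ord0 ix2 = 16 * (path s * f (path s) - 1)])) := e.
  rewrite /= !vec3_0 !vec3_1 !vec3_2 => h.
  have [e0 e1 e2] : [/\ scale * w = scale * path s, 16 * f w = 16 * f (path s) &
      16 * (w * f w - 1) = 16 * (path s * f (path s) - 1)] by rewrite h.
  by rewrite /disc_sqnorm e0 e1 e2 -/(disc_sqnorm _) hs; lra.
Qed.

End ThreeSpace.

Theorem theorem5p2 (R : realType) :
  exists J : set (CN R 3),
    [/\ is_arc J,
        poly_convex J,
        J `&` closed_unit_ball R 3 = set0
      & ~ rat_convex (closed_unit_ball R 3 `|` J)].
Proof.
have [gamma [f [fn [K [[cg gi E4] [[cfn cf fnf fb finf] [frat Koff Knear]]]]]]] :=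
  arc_with_potential R.
exists (arc3 gamma f); split.
- exact: (arc3_is_arc cg gi cf).
- exact: (arc3_poly_convex cg gi E4 cf fnf frat Koff).
- exact: (@arc3_off_ball R gamma f E4).
have [z [zr Bz Jz]] := disc_leaves_arc_and_ball E4 cf finf.
move=> rc; have : (closed_unit_ball R 3 `|` arc3 gamma f) (disc_map f z).
  rewrite -[X in X _]rc => p; rewrite /=.
  have [q qE] : is_poly_map (fun x => peval p x - peval p (disc_map f z)).
    by apply: is_poly_mapB; [exists p|exact: is_poly_map_cst].
  have qz : peval q (disc_map f z) = 0 by rewrite qE subrr.
  have [x Xx qx] := disc_map_zero cg E4 cfn cf fnf fb finf frat Knear zr qz.
  by exists x => //; apply/eqP; rewrite -subr_eq0 -qE qx.
by case.
Qed.
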